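(* Let $p\in\mathbb{N}$, let $\mathbf{f}_1,\dots,\mathbf{f}_p$ be non-zero elements of $\ell^2(\Lambda,\mathcal{M}_n)$, and suppose there is a positive real number $b_0$ such that $\|\mathcal{F}(\mathbf{f}_j)(x)\|_{\mathcal{M}_n}\le b_0$ for each $j\in\{1,\dots,p\}$ and a.e. $x\in\Omega$. For $m,k\in\{1,\dots,n\}$ and a.e. $x\in[0,\frac1{4N})$ let $\Gamma_{m,k}(x)$ be the $4N\times 2p$ matrix built from $\mathbf{f}_1,\dots,\mathbf{f}_p$ as defined in the context, and let $\Gamma_{m,k}^*(x)$ be its conjugate transpose. Let $a_0>0$. Then $\{\mathcal{D}_{2N\lambda}\mathbf{f}_j\}_{\lambda\in\Lambda,\,1\le j\le p}$ is a matrix-valued DFNS for $\ell^2(\Lambda,\mathcal{M}_n)$ with lower frame bound $a_0$ if and only if, for a.e. $x\in(0,\frac1{4N})$, $$\Big\|\sum_{m,k=1}^n\Gamma_{m,k}^*(x)\,\mathbf{w}_{m,k}\Big\|_{\mathbb{C}^{2p}}^2\ \ge\ 4Na_0\sum_{m,k=1}^n\|\mathbf{w}_{m,k}\|_{\mathbb{C}^{4N}}^2$$ for all $\mathbf{w}_{m,k}\in\mathbb{C}^{4N}$, $1\le m,k\le n$.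
   Context: Fix $n,N\in\mathbb{N}$ (positive integers) and an odd integer $r$ coprime to $N$ with $1\le r\le 2N-1$. Put $\Lambda=\{0,\frac{r}{N}\}+2\mathbb{Z}\subset\mathbb{R}$ and $\Omega=[0,\frac12)\cup[\frac N2,\frac{N+1}{2})$. $\mathcal{M}_n$ is the space of complex $n\times n$ matrices with norm $\|\mathbf{a}\|_{\mathcal{M}_n}=\big(\sum_{m,k=1}^n|a_{m,k}|^2\big)^{1/2}$. $\ell^2(\Lambda,\mathcal{M}_n)$ is the Hilbert space of maps $\mathbf{f}:\Lambda\to\mathcal{M}_n$ with $\sum_{\lambda\in\Lambda}\sum_{m,k=1}^n|f_{m,k}(\lambda)|^2<\infty$, with inner product $\langle\mathbf{f},\mathbf{g}\rangle=\sum_{\lambda\in\Lambda}\sum_{m,k=1}^n f_{m,k}(\lambda)\overline{g_{m,k}(\lambda)}$ and associated norm $\|\cdot\|_{\ell^2}$. $L^2(\Omega,\mathcal{M}_n)$ is the Hilbert space of $\mathcal{M}_n$-valued functions on $\Omega$ with entries in $L^2(\Omega)$ and inner product $\sum_{m,k}\int_\Omega F_{m,k}(x)\overline{G_{m,k}(x)}\,dx$. The Fourier transform $\mathcal{F}:\ell^2(\Lambda,\mathcal{M}_n)\to L^2(\Omega,\mathcal{M}_n)$ is defined entrywise by $\mathcal{F}(\mathbf{f})_{m,k}(x)=\sum_{\lambda\in\Lambda}f_{m,k}(\lambda)e^{2\pi i\lambda x}$ (convergence in $L^2(\Omega)$; $\{e^{2\pi i\lambda\cdot}\}_{\lambda\in\Lambda}$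 is a complete orthonormal system of $L^2(\Omega)$). For $\lambda\in\Lambda$, the displacement operator $\mathcal{D}_{2N\lambda}$ on $\ell^2(\Lambda,\mathcal{M}_n)$ is $(\mathcal{D}_{2N\lambda}\mathbf{f})(\lambda')=\mathbf{f}(\lambda'-2N\lambda)$, $\lambda'\in\Lambda$. For non-zero $\mathbf{f}_1,\dots,\mathbf{f}_p\in\ell^2(\Lambda,\mathcal{M}_n)$, the collection $\{\mathcal{D}_{2N\lambda}\mathbf{f}_j\}_{\lambda\in\Lambda,\,1\le j\le p}$ is a matrix-valued discrete frame of non-uniform shifts (matrix-valued DFNS) for $\ell^2(\Lambda,\mathcal{M}_n)$ if there exist $a,b\in(0,\infty)$ (a lower and an upper frame bound; not unique) with $a\|\mathbf{f}\|_{\ell^2}^2\le\sum_{j=1}^p\sum_{\lambda\in\Lambda}|\langle\mathbf{f},\mathcal{D}_{2N\lambda}\mathbf{f}_j\rangle|^2\le b\|\mathbf{f}\|_{\ell^2}^2$ for all $\mathbf{f}\in\ell^2(\Lambda,\mathcal{M}_n)$. ''With lower frame bound $a_0$'' means that these inequalities hold with $a=a_0$ and some $b\in(0,\infty)$. Definition of $\Gamma_{m,k}(x)$. For $j\in\{1,\dots,p\}$, $m,k\in\{1,\dots,n\}$ and (a.e.) $x\in[0,\frac1{4N})$, let $\Upsilon_{j,m,k}(x)\in\mathbb{C}^{4N}$ be the column vector whose $(g+1)$-th entry is $\mathcal{F}(\mathbf{f}_j)_{m,k}(x+\frac{g}{4N})$ and whose $(2N+g+1)$-th entry is $\mathcal{F}(\mathbf{f}_j)_{m,k}(x+\frac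 N2+\frac{g}{4N})$, for $g=0,1,\dots,2N-1$. Let $\mathbf{E}(x)\in\mathbb{C}^{4N}$ be the column vector whose $(g+1)$-th and $(2N+g+1)$-th entries are both $e^{4\pi i r(x+\frac{g}{4N})}$, $g=0,\dots,2N-1$, and let $\Psi_{j,m,k}(x)=\mathbf{E}(x)\odot\Upsilon_{j,m,k}(x)$ be the entrywise (Hadamard) product. Then $\Gamma_{m,k}(x)$ is the $4N\times 2p$ matrix with columns, in order, $$\Gamma_{m,k}(x)=\big[\Upsilon_{1,m,k}(x)\ \ \Psi_{1,m,k}(x)\ \ \Upsilon_{2,m,k}(x)\ \ \Psi_{2,m,k}(x)\ \cdots\ \Upsilon_{p,m,k}(x)\ \ \Psi_{p,m,k}(x)\big].$$ $\|\cdot\|_{\mathbb{C}^{d}}$ is the Euclidean norm. *)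

(* Defs.v *)
From HB Require Import structures.
From mathcomp Require Import all_boot all_order all_algebra finmap complex.
From mathcomp Require Import all_classical all_reals all_analysis.
From mathcomp Require Import ring.

Set Implicit Arguments.
Unset Strict Implicit.
Unset Printing Implicit Defensive.

Import Order.TTheory GRing.Theory Num.Theory numFieldNormedType.Exports.
Import Normc.

Local Open Scope classical_set_scope.
Local Open Scope ring_scope.
Local Open Scope complex_scope.

Section Defs.
Variable R : realType.
Local Notation C := R[i].
Local Notation mu := (@lebesgue_measure R).

(* [normc] is the modulus with values in [R]; on columns [enorm] is the
   Euclidean norm, on square matrices the norm of $\mathcal{M}_n$. *)
Definition enorm (m k : nat) (A : 'M[C]_(m, k)) : R :=
  Num.sqrt (\sum_i \sum_j normc (A i j) ^+ 2).

Definition expi (t : R) : C := cos t +i* sin t.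

Section Lambda.
Variables N r : nat.

Definition Lambda : set R :=
  [set x | exists z : int,
    x = 2 * z%:~R \/ x = r%:R / N%:R + 2 * z%:~R].

Definition Omega : set R :=
  `[0, 1 / 2[%classic `|` `[N%:R / 2, (N%:R + 1) / 2[%classic.

Lemma Lambda_shift (x y : R) :
  Lambda x -> Lambda y -> Lambda (x - 2 * N%:R * y).
Proof.
move=> Lx Ly.
have [z ->] : exists z : int, 2 * N%:R * y = 2 * z%:~R.
  case: Ly => z [->|->].
    by exists (2 * N%:Z * z); rewrite !intrM; ring.
  have [->|N0] := eqVneq N 0%N; first by exists 0; rewrite !(mulr0n, mulr0z, mulr0, mul0r).
  exists (r%:Z + 2 * N%:Z * z); rewrite intrD !intrM /= mulrDr.
  have N0' : N%:R != 0 :> R by rewrite pnatr_eq0.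
  by rewrite mulrDr -[2 * N%:R * _]mulrA [N%:R * _]mulrC divfK //; ring.
case: Lx => t [->|->]; exists (t - z); rewrite intrB; [left|right]; ring.
Qed.

Lemma Lambda_shift_mem (x y : Lambda) :
  val x - 2 * N%:R * val y \in Lambda.
Proof. exact/mem_set/Lambda_shift/set_valP/set_valP. Qed.

Definition Lambda_sub (x y : Lambda) : Lambda :=
  exist (fun z => z \in Lambda) _ (Lambda_shift_mem x y).

(* Sum of an absolutely summable family; the value is only meaningful for
   such families. *)
Definition rsum (u : Lambda -> R) : R :=
  fine (\esum_(l in [set: Lambda]) (Num.max (u l) 0)%:E)
  - fine (\esum_(l in [set: Lambda]) (Num.max (- u l) 0)%:E).

Definition csum (u : Lambda -> C) : C :=
  rsum (fun l => complex.Re (u l)) +i* rsum (fun l => complex.Im (u l)).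

Definition L2_Omega (F : R -> C) : Prop :=
  [/\ measurable_fun Omega (fun x => complex.Re (F x)),
      measurable_fun Omega (fun x => complex.Im (F x)) &
      (\int[mu]_(x in Omega) (normc (F x) ^+ 2)%:E < +oo)%E].

(* [F] represents the sum of $\sum_{\lambda} u(\lambda) e^{2\pi i\lambda x}$,
   as an unconditionally convergent series in $L^2(\Omega)$. *)
Definition is_fourier (u : Lambda -> C) (F : R -> C) : Prop :=
  L2_Omega F /\
  forall e : R, 0 < e -> exists A : {fset Lambda}, forall B : {fset Lambda},
    (A `<=` B)%fset ->
    (\int[mu]_(x in Omega)
       (normc (F x - \sum_(l <- B) u l * expi (2 * pi * val l * x)) ^+ 2)%:E
     <= e%:E)%E.

(* A chosen representative of the $L^2(\Omega)$ class (unique up to null sets;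
   it exists for square-summable [u]). *)
Definition fourier_scalar (u : Lambda -> C) : R -> C :=
  xget (fun=> 0) [set F | is_fourier u F].

Section Space.
Variable n : nat.
Local Notation seqM := (Lambda -> 'M[C]_n).

Definition l2 (f : seqM) : Prop :=
  (\esum_(l in [set: Lambda]) (enorm (f l) ^+ 2)%:E < +oo)%E.

Definition l2norm (f : seqM) : R :=
  Num.sqrt (fine (\esum_(l in [set: Lambda]) (enorm (f l) ^+ 2)%:E)).

Definition l2dot (f g : seqM) : C :=
  csum (fun l => \sum_m \sum_k f l m k * (g l m k)^*).

Definition fourier (f : seqM) (x : R) : 'M[C]_n :=
  \matrix_(m, k) fourier_scalar (fun l => f l m k) x.

(* The operator $\mathcal{D}_{2N\lambda}$. *)
Definition displacement (l : Lambda) (f : seqM) : seqM :=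
  fun l' => f (Lambda_sub l' l).

Section System.
Variable p : nat.
Variable f : 'I_p -> seqM.

Definition frame_inequalities (a b : R) : Prop :=
  forall g : seqM, l2 g ->
    ((a * l2norm g ^+ 2)%:E <=
       \sum_(j < p) \esum_(l in [set: Lambda])
         (normc (l2dot g (displacement l (f j))) ^+ 2)%:E)%E /\
    (\sum_(j < p) \esum_(l in [set: Lambda])
         (normc (l2dot g (displacement l (f j))) ^+ 2)%:E
       <= (b * l2norm g ^+ 2)%:E)%E.

Definition DFNS_with_lower_bound (a : R) : Prop :=
  0 < a /\ exists2 b : R, 0 < b & frame_inequalities a b.

(* 0-based row [i] stands for the block index [g = i %% (2 * N)], in the block
   shifted by $N/2$ when [2 * N <= i]. *)
Definition Upsilon (j : 'I_p) (m k : 'I_n) (x : R) : 'cV[C]_(4 * N) :=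
  \col_(i < 4 * N)
    if (i < 2 * N)%N then fourier (f j) (x + i%:R / (4 * N)%:R) m k
    else fourier (f j)
           (x + N%:R / 2 + (i - 2 * N)%N%:R / (4 * N)%:R) m k.

Definition Evec (x : R) : 'cV[C]_(4 * N) :=
  \col_(i < 4 * N)
    expi (4 * pi * r%:R * (x + (i %% (2 * N))%N%:R / (4 * N)%:R)).

Definition Psi (j : 'I_p) (m k : 'I_n) (x : R) : 'cV[C]_(4 * N) :=
  map2_mx *%R (Evec x) (Upsilon j m k x).

Lemma half_ord_subproof (c : 'I_(2 * p)) : (c./2 < p)%N.
Proof. by rewrite ltn_half_double -mul2n. Qed.

Definition half_ord (c : 'I_(2 * p)) : 'I_p := Ordinal (half_ord_subproof c).

(* Columns $\Upsilon_1, \Psi_1, \Upsilon_2, \Psi_2, \dots$ *)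
Definition Gamma (m k : 'I_n) (x : R) : 'M[C]_(4 * N, 2 * p) :=
  \matrix_(i, c)
    (if odd c then Psi (half_ord c) m k x
     else Upsilon (half_ord c) m k x) i 0.

End System.
End Space.
End Lambda.
End Defs.

Arguments Lambda R N r : clear implicits.
Arguments Omega R N : clear implicits.

(* Main.v *)
Require Import Defs.
From HB Require Import structures.
From mathcomp Require Import all_boot all_order all_algebra finmap complex.
From mathcomp Require Import all_classical all_reals all_analysis.
From mathcomp Require Import measurable_realfun zify ring lra.

(** The Fourier transform carries $\ell^2(\Lambda,\mathcal M_n)$ isometrically onto
    $L^2(\Omega,\mathcal M_n)$ and turns the displacement by $2N\lambda$ into
    multiplication by $e^{2\pi i\cdot 2N\lambda x}$. The frame coefficient of $g$ against
    the displacement of $f_j$ is therefore the integral over $\Omega$ of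
    $H_j(x)e^{-2\pi i\cdot 2N\lambda x}$, with $H_j=\sum_{m,k}G_{m,k}\overline{F_{j,m,k}}$,
    which is square-integrable because the $F_j$ are bounded. For
    $\lambda\in2\mathbb Z$ these exponentials are exactly those of period $1/(4N)$, and for
    the other coset of $2\mathbb Z$ they are the same ones multiplied by
    $e^{-4\pi irx}$. The set $\Omega$ is the disjoint union of $4N$ translates of the
    cell $[0,1/(4N))$ ([grid_tiling]), so the integral folds onto the cell, and Parseval's
    identity on the cell, applied to each coset ([fold_parseval]), shows that the frame
    sum is $\frac1{4N}$ times the integral over the cell of
    $\|\sum_{m,k}\Gamma_{m,k}^*W_{m,k}\|^2$, where $W_{m,k}(x)$ lists the values of
    $G_{m,k}$ at the $4N$ translates of $x$ ([frame_sum]). Likewise $\|g\|^2$ is the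
    integral over the cell of $\sum_{m,k}\|W_{m,k}\|^2$ ([fiber_integral]).

    The fiberwise inequality thus integrates to the lower frame bound
    ([frame_of_fibers]), and the upper bound follows from the boundedness of the $F_j$.
    Conversely, every $W=1_Aw$ with $w$ a constant vector and $A$ a measurable part of
    the cell comes from some $g$, because the exponentials with frequencies in $\Lambda$
    are total. Taking for $A$ the set where the inequality fails for $w$ shows that it is
    null ([fiber_bound_ae]); countably many rational vectors $w$ and continuity in $w$
    give all vectors at almost every $x$ ([fibers_of_frame]).

    The Fourier analysis rests on an abstract Riesz-Fischer theorem for orthonormal
    systems ([riesz_fischer]) and on the totality of two systems. On an interval a
    function orthogonal to all exponentials is orthogonal to all trigonometric
    polynomials $(1-t^n)^{2^n}$, where $t$ is a trigonometric polynomial with values in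
    $[0,1]$ that is below $1/2$ exactly on an initial interval; letting $n\to\infty$, its
    integrals over initial intervals vanish ([orthogonal_waves_ae0]). On $\Omega$ the two
    halves are folded onto $[0,1/2)$: as $r$ is odd, the frequencies in the two cosets of
    $2\mathbb Z$ see the sum and the difference of the two halves ([lwave_total]). *)

Set Implicit Arguments.
Unset Strict Implicit.
Unset Printing Implicit Defensive.

Import Order.TTheory GRing.Theory Num.Theory numFieldNormedType.Exports.
Import Normc.

Local Open Scope classical_set_scope.
Local Open Scope ring_scope.
Local Open Scope complex_scope.

(* The conjugation of [complex] in both scopes; [conjCE] identifies it with the
   generic one. *)
Local Notation "z ^*" := (conjc z) : ring_scope.

(** * Complex-valued integrals and square-integrable functions *)

Section ComplexModulus.
Variable R : rcfType.
Implicit Types z w : R[i].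
Local Notation Re := (@complex.Re R).
Local Notation Im := (@complex.Im R).

Lemma cReD z w : Re (z + w) = Re z + Re w. Proof. by case: z; case: w. Qed.
Lemma cImD z w : Im (z + w) = Im z + Im w. Proof. by case: z; case: w. Qed.
Lemma cReN z : Re (- z) = - Re z. Proof. by case: z. Qed.
Lemma cImN z : Im (- z) = - Im z. Proof. by case: z. Qed.
Lemma cReM z w : Re (z * w) = Re z * Re w - Im z * Im w.
Proof. by case: z; case: w. Qed.
Lemma cImM z w : Im (z * w) = Re z * Im w + Im z * Re w.
Proof. by case: z; case: w. Qed.
Lemma cReJ z : Re z^* = Re z. Proof. by case: z. Qed.
Lemma cImJ z : Im z^* = - Im z. Proof. by case: z. Qed.

Lemma cRe_sum I (s : seq I) (P : pred I) (F : I -> R[i]) :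
  Re (\sum_(i <- s | P i) F i) = \sum_(i <- s | P i) Re (F i).
Proof. exact: (big_morph Re cReD). Qed.

Lemma cIm_sum I (s : seq I) (P : pred I) (F : I -> R[i]) :
  Im (\sum_(i <- s | P i) F i) = \sum_(i <- s | P i) Im (F i).
Proof. exact: (big_morph Im cImD). Qed.

Lemma conjCE z : Num.conj z = z^*. Proof. by []. Qed.

Lemma conjcM z w : (z * w)^* = z^* * w^*. Proof. exact: rmorphM. Qed.

Lemma conjc_sum I (s : seq I) (P : pred I) (F : I -> R[i]) :
  (\sum_(i <- s | P i) F i)^* = \sum_(i <- s | P i) (F i)^*.
Proof. exact: rmorph_sum. Qed.

Lemma complexP z w : Re z = Re w -> Im z = Im w -> z = w.
Proof. by case: z => a b; case: w => a' b' /= -> ->. Qed.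

Lemma normc2E z : normc z ^+ 2 = Re z ^+ 2 + Im z ^+ 2.
Proof. by case: z => a b /=; rewrite sqr_sqrtr// addr_ge0// sqr_ge0. Qed.

Lemma normc_ge0 z : 0 <= normc z.
Proof. by case: z => a b /=; rewrite sqrtr_ge0. Qed.

Lemma mulcJ z : z * z^* = (normc z ^+ 2)%:C.
Proof.
apply: complexP; rewrite ?cReM ?cImM cReJ cImJ normc2E /=; ring.
Qed.

Lemma Re_mulcJ z : Re (z * z^*) = normc z ^+ 2.
Proof. by rewrite mulcJ. Qed.

Lemma normcJ_sq z : normc z^* = normc z.
Proof. by case: z => a b /=; rewrite sqrrN. Qed.

Lemma normc_eq0 z : (normc z == 0) = (z == 0).
Proof. by apply/eqP/eqP => [/eq0_normc//|->]; rewrite normc0. Qed.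

Lemma normc2D_le z w : normc (z + w) ^+ 2 <= 2 * (normc z ^+ 2 + normc w ^+ 2).
Proof.
rewrite !normc2E cReD cImD.
have := sqr_ge0 (Re z - Re w); have := sqr_ge0 (Im z - Im w); nra.
Qed.

Lemma normc_opp z : normc (- z) = normc z.
Proof. by case: z => a b /=; rewrite !sqrrN. Qed.

Lemma Re_le_normc z : `|Re z| <= normc z.
Proof.
rewrite -(@ler_pXn2r _ 2)// ?nnegrE// ?normc_ge0//.
by rewrite real_normK ?num_real// normc2E lerDl sqr_ge0.
Qed.

Lemma Im_le_normc z : `|Im z| <= normc z.
Proof.
rewrite -(@ler_pXn2r _ 2)// ?nnegrE// ?normc_ge0//.
by rewrite real_normK ?num_real// normc2E lerDr sqr_ge0.
Qed.

Lemma normc2_sum_le (I : finType) (z : I -> R[i]) :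
  normc (\sum_i z i) ^+ 2 <= #|I|%:R * \sum_i normc (z i) ^+ 2.
Proof.
have real_case (a : I -> R) : (\sum_i a i) ^+ 2 <= #|I|%:R * \sum_i a i ^+ 2.
  (* Lagrange's identity. *)
  have : 0 <= \sum_i \sum_j (a i - a j) ^+ 2.
    by apply: sumr_ge0 => i _; apply: sumr_ge0 => j _; exact: sqr_ge0.
  have -> : \sum_i \sum_j (a i - a j) ^+ 2 =
      2 * (#|I|%:R * \sum_i a i ^+ 2) - 2 * (\sum_i a i) ^+ 2.
    transitivity (\sum_i
        (#|I|%:R * a i ^+ 2 - 2 * a i * (\sum_j a j) + \sum_j a j ^+ 2)).
      apply: eq_bigr => i _.
      under eq_bigr do rewrite sqrrB.
      rewrite big_split /= sumrB sumr_const cardT -cardE mulr_natl.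
      by rewrite mulr_sumr; congr (_ - _ + _); apply: eq_bigr => j _; ring.
    rewrite big_split /= sumrB -mulr_sumr -mulr_suml -mulr_sumr sumr_const.
    by rewrite cardT -cardE mulr_natl; ring.
  lra.
rewrite normc2E cRe_sum cIm_sum; apply: le_trans (lerD (real_case _) (real_case _)) _.
rewrite -mulrDr -big_split /= ler_wpM2l//.
by apply: ler_sum => i _; rewrite normc2E.
Qed.

End ComplexModulus.

Section ComplexIntegral.
Context d (T : measurableType d) (R : realType).
Variables (mu : {measure set T -> \bar R}) (D : set T).
Hypothesis mD : measurable D.
Local Notation C := R[i].
Local Notation Re := (@complex.Re R).
Local Notation Im := (@complex.Im R).
Implicit Types F G : T -> C.

Definition cmeasurable F :=
  measurable_fun D (fun x => Re (F x)) /\ measurable_fun D (fun x => Im (F x)).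

Definition cintegrable F :=
  mu.-integrable D (EFin \o (fun x => Re (F x))) /\
  mu.-integrable D (EFin \o (fun x => Im (F x))).

Definition cint F : C :=
  (\int[mu]_(x in D) Re (F x)) +i* (\int[mu]_(x in D) Im (F x)).

Lemma eq_cmeasurable F G : F =1 G -> cmeasurable F -> cmeasurable G.
Proof. by move=> /funext ->. Qed.

Lemma cmeasurableD F G :
  cmeasurable F -> cmeasurable G -> cmeasurable (fun x => F x + G x).
Proof.
move=> [F1 F2] [G1 G2]; split.
  by under eq_fun do rewrite cReD; exact: measurable_funD.
by under eq_fun do rewrite cImD; exact: measurable_funD.
Qed.

Lemma cmeasurableN F : cmeasurable F -> cmeasurable (fun x => - F x).
Proof.
move=> [F1 F2]; split.
  by under eq_fun do rewrite cReN; exact: measurableT_comp.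
by under eq_fun do rewrite cImN; exact: measurableT_comp.
Qed.

Lemma cmeasurableB F G :
  cmeasurable F -> cmeasurable G -> cmeasurable (fun x => F x - G x).
Proof. by move=> mF mG; apply: cmeasurableD => //; exact: cmeasurableN. Qed.

Lemma cmeasurableM F G :
  cmeasurable F -> cmeasurable G -> cmeasurable (fun x => F x * G x).
Proof.
move=> [F1 F2] [G1 G2]; split.
  by under eq_fun do rewrite cReM; apply: measurable_funB; exact: measurable_funM.
by under eq_fun do rewrite cImM; apply: measurable_funD; exact: measurable_funM.
Qed.

Lemma cmeasurableJ F : cmeasurable F -> cmeasurable (fun x => (F x)^*).
Proof.
move=> [F1 F2]; split; first by under eq_fun do rewrite cReJ.
by under eq_fun do rewrite cImJ; exact: measurableT_comp.
Qed.

Lemma cmeasurable_cst z : cmeasurable (fun=> z).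
Proof. by split; exact: measurable_cst. Qed.

Lemma cmeasurable_sum I (s : seq I) (F : I -> T -> C) :
  (forall i, cmeasurable (F i)) -> cmeasurable (fun x => \sum_(i <- s) F i x).
Proof.
move=> mF; elim: s => [|i s IH].
  by under eq_fun do rewrite big_nil; exact: cmeasurable_cst.
by under eq_fun do rewrite big_cons; exact: cmeasurableD.
Qed.

Lemma measurable_normc2 F :
  cmeasurable F -> measurable_fun D (fun x => normc (F x) ^+ 2).
Proof.
move=> [F1 F2]; under eq_fun do rewrite normc2E.
by apply: measurable_funD; exact: measurable_funX.
Qed.

Lemma le_cintegrable F (g : T -> R) : cmeasurable F ->
  mu.-integrable D (EFin \o g) -> (forall x, D x -> normc (F x) <= g x) ->
  cintegrable F.
Proof.
move=> [F1 F2] ig Fg; split; apply: le_integrable ig => //.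
- exact/measurable_EFinP.
- move=> x Dx /=; rewrite lee_fin (le_trans (Re_le_normc _))//.
  by rewrite (le_trans (Fg _ Dx))// ler_norm.
- exact/measurable_EFinP.
- move=> x Dx /=; rewrite lee_fin (le_trans (Im_le_normc _))//.
  by rewrite (le_trans (Fg _ Dx))// ler_norm.
Qed.

Lemma cintegrableD F G :
  cintegrable F -> cintegrable G -> cintegrable (fun x => F x + G x).
Proof.
move=> [F1 F2] [G1 G2]; split.
  apply: eq_integrable (integrableD mD F1 G1) => // x _.
  by rewrite /= cReD EFinD.
apply: eq_integrable (integrableD mD F2 G2) => // x _.
by rewrite /= cImD EFinD.
Qed.

Lemma integrable_lincomb (f g : T -> R) a b :
  mu.-integrable D (EFin \o f) -> mu.-integrable D (EFin \o g) ->
  mu.-integrable D (EFin \o (fun x => a * f x + b * g x)).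
Proof.
move=> If Ig.
exact: (integrableD mD (integrableZl mD a If) (integrableZl mD b Ig)).
Qed.

Lemma Rintegral_lincomb (f g : T -> R) a b :
  mu.-integrable D (EFin \o f) -> mu.-integrable D (EFin \o g) ->
  \int[mu]_(x in D) (a * f x + b * g x) =
  a * \int[mu]_(x in D) f x + b * \int[mu]_(x in D) g x.
Proof.
move=> If Ig; rewrite RintegralD// ?RintegralZl//.
- exact: (integrableZl mD a If).
- exact: (integrableZl mD b Ig).
Qed.

Lemma cintegrableZl z F : cintegrable F -> cintegrable (fun x => z * F x).
Proof.
move=> [F1 F2]; split.
  apply: eq_integrable (integrable_lincomb (Re z) (- Im z) F1 F2) => // x _.
  by rewrite /= cReM mulNr.
apply: eq_integrable (integrable_lincomb (Im z) (Re z) F1 F2) => // x _.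
by rewrite /= cImM addrC.
Qed.

Lemma cintegrable0 : cintegrable (fun=> 0).
Proof. by split; exact: integrable0. Qed.

Lemma cintegrable_sum I (s : seq I) (F : I -> T -> C) :
  (forall i, cintegrable (F i)) -> cintegrable (fun x => \sum_(i <- s) F i x).
Proof.
move=> iF; elim: s => [|i s IH].
  by under eq_fun do rewrite big_nil; exact: cintegrable0.
by under eq_fun do rewrite big_cons; exact: cintegrableD.
Qed.

Lemma eq_cint F G : (forall x, D x -> F x = G x) -> cint F = cint G.
Proof.
by move=> FG; congr (_ +i* _); apply: eq_Rintegral => x /set_mem Dx; rewrite FG.
Qed.

Lemma cintD F G : cintegrable F -> cintegrable G ->
  cint (fun x => F x + G x) = cint F + cint G.
Proof.
move=> [F1 F2] [G1 G2]; rewrite /cint; apply: complexP; rewrite /= -RintegralD//.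
  by apply: eq_Rintegral => x _; rewrite cReD.
by apply: eq_Rintegral => x _; rewrite cImD.
Qed.

Lemma cintZl z F : cintegrable F -> cint (fun x => z * F x) = z * cint F.
Proof.
move=> [F1 F2]; apply: complexP; rewrite ?cReM ?cImM /=.
  rewrite -mulNr -Rintegral_lincomb//; apply: eq_Rintegral => x _.
  by rewrite cReM mulNr.
rewrite -Rintegral_lincomb//; apply: eq_Rintegral => x _.
by rewrite cImM.
Qed.

Lemma cintJ F : cintegrable F -> cint (fun x => (F x)^*) = (cint F)^*.
Proof.
move=> [F1 F2]; apply: complexP; rewrite ?cReJ ?cImJ /=.
  by apply: eq_Rintegral => x _; rewrite cReJ.
rewrite -mulN1r -RintegralZl//; apply: eq_Rintegral => x _.
by rewrite cImJ mulN1r.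
Qed.

Lemma cint0 : cint (fun=> 0) = 0.
Proof. by rewrite /cint /= Rintegral_cst// mul0r. Qed.

Lemma cint_sum I (s : seq I) (F : I -> T -> C) :
  (forall i, cintegrable (F i)) ->
  cint (fun x => \sum_(i <- s) F i x) = \sum_(i <- s) cint (F i).
Proof.
move=> iF; elim: s => [|i s IH].
  by under eq_fun do rewrite big_nil; rewrite cint0 big_nil.
rewrite big_cons -IH -cintD//; last exact: cintegrable_sum.
by apply: eq_cint => x _; rewrite big_cons.
Qed.

Lemma cintB F G : cintegrable F -> cintegrable G ->
  cint (fun x => F x - G x) = cint F - cint G.
Proof.
move=> iF iG; rewrite -mulN1r -cintZl// -cintD//; last exact: cintegrableZl.
by apply: eq_cint => x _; rewrite mulN1r.
Qed.

(** * Square-integrable functions *)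

Definition sqintegrable F := cmeasurable F /\
  mu.-integrable D (EFin \o (fun x => normc (F x) ^+ 2)).

Definition sqnorm F : R := \int[mu]_(x in D) (normc (F x) ^+ 2).

Definition inner F G : C := cint (fun x => F x * (G x)^*).

Lemma sqintegrable_dom F (g : T -> R) : cmeasurable F ->
  mu.-integrable D (EFin \o g) -> (forall x, D x -> normc (F x) ^+ 2 <= g x) ->
  sqintegrable F.
Proof.
move=> mF ig Fg; split => //; apply: le_integrable ig => //.
  by apply/measurable_EFinP; exact: measurable_normc2.
move=> x Dx /=; rewrite lee_fin ger0_norm ?sqr_ge0//.
by rewrite (le_trans (Fg _ Dx))// ler_norm.
Qed.

Lemma sqintegrableD F G :
  sqintegrable F -> sqintegrable G -> sqintegrable (fun x => F x + G x).
Proof.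
move=> [mF iF] [mG iG].
apply: (sqintegrable_dom _ (integrable_lincomb 2 2 iF iG)).
  exact: cmeasurableD.
by move=> x _; rewrite -mulrDr normc2D_le.
Qed.

Lemma sqintegrableM_bounded F G b : sqintegrable F -> cmeasurable G ->
  (forall x, D x -> normc (G x) <= b) -> sqintegrable (fun x => F x * G x).
Proof.
move=> [mF iF] mG Gb.
apply: (@sqintegrable_dom _ (fun x => b ^+ 2 * normc (F x) ^+ 2)).
- exact: cmeasurableM.
- exact: (integrableZl mD (b ^+ 2) iF).
move=> x Dx; rewrite normcM exprMn mulrC ler_wpM2r ?sqr_ge0//.
by rewrite lerXn2r// ?nnegrE ?normc_ge0 ?Gb// (le_trans (normc_ge0 _) (Gb _ Dx)).
Qed.

Lemma sqintegrableM_ae_bounded F G b : sqintegrable F -> cmeasurable G ->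
  {ae mu, forall x, D x -> normc (G x) <= b} -> sqintegrable (fun x => F x * G x).
Proof.
move=> iF mG Gb; have mFG := cmeasurableM iF.1 mG; split => //.
have mn := measurable_normc2 mFG.
apply/integrableP; split; first exact/measurable_EFinP.
have ib : mu.-integrable D (EFin \o (fun x => b ^+ 2 * normc (F x) ^+ 2)).
  exact: (integrableZl mD (b ^+ 2) iF.2).
have [/measurable_EFinP mb bfin] := integrableP _ _ _ ib.
apply: le_lt_trans bfin; apply: ae_ge0_le_integral => //.
- by apply: measurableT_comp => //; exact/measurable_EFinP.
- by apply: measurableT_comp => //; exact/measurable_EFinP.
apply: filterS Gb => x + Dx => /(_ Dx) hb.
have h2 : 0 <= b ^+ 2 * normc (F x) ^+ 2 by apply: mulr_ge0; exact: sqr_ge0.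
rewrite /comp !abse_EFin lee_fin !ger0_norm ?sqr_ge0// normcM exprMn mulrC.
rewrite ler_wpM2r ?sqr_ge0// lerXn2r// ?nnegrE ?normc_ge0//.
exact: le_trans (normc_ge0 _) hb.
Qed.

Lemma sqintegrableZl z F : sqintegrable F -> sqintegrable (fun x => z * F x).
Proof.
move=> iF; under eq_fun do rewrite mulrC.
by apply: (@sqintegrableM_bounded _ _ (normc z)) => //; exact: cmeasurable_cst.
Qed.

Lemma sqintegrableN F : sqintegrable F -> sqintegrable (fun x => - F x).
Proof.
by move=> /(sqintegrableZl (- 1)); under eq_fun do rewrite mulN1r.
Qed.

Lemma sqintegrableB F G :
  sqintegrable F -> sqintegrable G -> sqintegrable (fun x => F x - G x).
Proof. by move=> iF iG; apply: sqintegrableD => //; exact: sqintegrableN. Qed.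

Lemma sqintegrable0 : sqintegrable (fun=> 0).
Proof.
split; first exact: cmeasurable_cst.
apply: eq_integrable (integrable0 mu D) => // x _.
by rewrite [RHS]/comp normc0 expr0n.
Qed.

Lemma sqintegrable_sum I (s : seq I) (F : I -> T -> C) :
  (forall i, sqintegrable (F i)) -> sqintegrable (fun x => \sum_(i <- s) F i x).
Proof.
move=> iF; elim: s => [|i s IH].
  by under eq_fun do rewrite big_nil; exact: sqintegrable0.
by under eq_fun do rewrite big_cons; exact: sqintegrableD.
Qed.

Lemma sqintegrableJ F : sqintegrable F -> sqintegrable (fun x => (F x)^*).
Proof.
move=> [mF iF]; split; first exact: cmeasurableJ.
by apply: eq_integrable iF => // x _ /=; rewrite normcJ_sq.
Qed.

Lemma cintegrable_mul F G : sqintegrable F -> sqintegrable G ->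
  cintegrable (fun x => F x * G x).
Proof.
move=> [mF iF] [mG iG].
apply: (@le_cintegrable _ (fun x => 1 * normc (F x) ^+ 2 + 1 * normc (G x) ^+ 2)).
- exact: cmeasurableM.
- exact: integrable_lincomb.
move=> x _; rewrite normcM !mul1r.
have := sqr_ge0 (normc (F x) - normc (G x)).
have := sqr_ge0 (normc (F x)); have := sqr_ge0 (normc (G x)); nra.
Qed.

Lemma inner_integrable F G : sqintegrable F -> sqintegrable G ->
  cintegrable (fun x => F x * (G x)^*).
Proof. by move=> iF iG; apply: cintegrable_mul => //; exact: sqintegrableJ. Qed.

Lemma innerJ F G : sqintegrable F -> sqintegrable G ->
  inner G F = (inner F G)^*.
Proof.
move=> iF iG; rewrite /inner -cintJ; last exact: inner_integrable.
by apply: eq_cint => x _; rewrite rmorphM /= conjcK mulrC.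
Qed.

Lemma innerDl F G H : sqintegrable F -> sqintegrable G -> sqintegrable H ->
  inner (fun x => F x + G x) H = inner F H + inner G H.
Proof.
move=> iF iG iH; rewrite /inner -cintD; try exact: inner_integrable.
by apply: eq_cint => x _; rewrite mulrDl.
Qed.

Lemma innerBl F G H : sqintegrable F -> sqintegrable G -> sqintegrable H ->
  inner (fun x => F x - G x) H = inner F H - inner G H.
Proof.
move=> iF iG iH; rewrite /inner -cintB; try exact: inner_integrable.
by apply: eq_cint => x _; rewrite mulrBl.
Qed.

Lemma innerZl z F H : sqintegrable F -> sqintegrable H ->
  inner (fun x => z * F x) H = z * inner F H.
Proof.
move=> iF iH; rewrite /inner -cintZl; last exact: inner_integrable.
by apply: eq_cint => x _; rewrite mulrA.
Qed.

Lemma inner_suml I (s : seq I) (F : I -> T -> C) H :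
  (forall i, sqintegrable (F i)) -> sqintegrable H ->
  inner (fun x => \sum_(i <- s) F i x) H = \sum_(i <- s) inner (F i) H.
Proof.
move=> iF iH; rewrite /inner -cint_sum; last by move=> i; exact: inner_integrable.
by apply: eq_cint => x _; rewrite mulr_suml.
Qed.

Lemma innerBr F G H : sqintegrable F -> sqintegrable G -> sqintegrable H ->
  inner F (fun x => G x - H x) = inner F G - inner F H.
Proof.
move=> iF iG iH.
rewrite (innerJ (sqintegrableB iG iH) iF) innerBl//.
by rewrite (innerJ iF iG) (innerJ iF iH) -rmorphB conjcK.
Qed.

Lemma inner_norm F : inner F F = (sqnorm F)%:C.
Proof.
apply: complexP => /=; first by apply: eq_Rintegral => x _; rewrite Re_mulcJ.
rewrite -[RHS](mul0r (fine (mu D))) -Rintegral_cst//.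
by apply: eq_Rintegral => x _; rewrite mulcJ.
Qed.

Lemma sqnorm_ge0 F : 0 <= sqnorm F.
Proof. by apply: Rintegral_ge0 => x _; rewrite sqr_ge0. Qed.

Lemma eq_sqnorm F G : (forall x, D x -> F x = G x) -> sqnorm F = sqnorm G.
Proof. by move=> FG; apply: eq_Rintegral => x /set_mem Dx; rewrite FG. Qed.

Lemma sqnormB F G : sqintegrable F -> sqintegrable G ->
  sqnorm (fun x => F x - G x) = sqnorm F - 2 * Re (inner F G) + sqnorm G.
Proof.
move=> iF iG.
have iFG := sqintegrableB iF iG.
have -> : sqnorm (fun x => F x - G x) =
   Re (inner (fun x => F x - G x) (fun x => F x - G x)) by rewrite inner_norm.
rewrite innerBl// !innerBr// (innerJ iF iG) !inner_norm.
rewrite !cReD !cReN !cReD !cReN cReJ /=; ring.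
Qed.

Lemma sqnormD_le F G : sqintegrable F -> sqintegrable G ->
  sqnorm (fun x => F x + G x) <= 2 * sqnorm F + 2 * sqnorm G.
Proof.
move=> iF iG; rewrite /sqnorm -Rintegral_lincomb; [|exact: iF.2|exact: iG.2].
apply: le_Rintegral => //.
- exact: (sqintegrableD iF iG).2.
- exact: integrable_lincomb iF.2 iG.2.
by move=> x _; rewrite -mulrDr normc2D_le.
Qed.

Lemma sqnormE F : sqintegrable F ->
  (\int[mu]_(x in D) (normc (F x) ^+ 2)%:E)%E = (sqnorm F)%:E.
Proof. by move=> [_ iF]; rewrite fineK//; exact: integrable_fin_num iF. Qed.

Lemma integrable_bigsum (I : finType) (h : I -> T -> R) :
  (forall i, mu.-integrable D (EFin \o h i)) ->
  mu.-integrable D (EFin \o (fun x => \sum_i h i x)).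
Proof.
move=> ih; have := integrable_sum mD (index_enum I) (P := xpredT)
  (h := fun i => EFin \o h i) (fun i _ => ih i).
by apply: eq_integrable => // x _; rewrite /= -sumEFin.
Qed.

Lemma Rintegral_bigsum (I : finType) (h : I -> T -> R) :
  (forall i, mu.-integrable D (EFin \o h i)) ->
  \int[mu]_(x in D) (\sum_i h i x) = \sum_i \int[mu]_(x in D) h i x.
Proof.
move=> ih; rewrite /Rintegral; under eq_integral do rewrite -sumEFin.
rewrite (@integral_sum _ _ _ mu D mD _ (fun i => EFin \o h i) ih).
apply: EFin_inj; rewrite -sumEFin fineK.
  by apply: eq_bigr => i _; rewrite fineK//; exact: (integrable_fin_num mD (ih i)).
by apply/sum_fin_numP => i _ _; exact: (integrable_fin_num mD (ih i)).
Qed.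

Lemma sqnorm_sum_le (I : finType) (F : I -> T -> C) :
  (forall i, sqintegrable (F i)) ->
  sqnorm (fun x => \sum_i F i x) <= #|I|%:R * \sum_i sqnorm (F i).
Proof.
move=> iF; rewrite /sqnorm -Rintegral_bigsum => [|i]; last exact: (iF i).2.
have isum := integrable_bigsum (fun i => (iF i).2).
rewrite -RintegralZl//; apply: le_Rintegral => //.
- exact: (sqintegrable_sum (index_enum I) iF).2.
- exact: (integrableZl mD #|I|%:R isum).
- by move=> x _; exact: normc2_sum_le.
Qed.

Hypothesis muD : (mu D < +oo)%E.

Lemma integrable_cst_ltoo (k : R) : mu.-integrable D (EFin \o cst k).
Proof.
apply/integrableP; split; first exact/measurable_EFinP.
rewrite [ltLHS](_ : _ = (`|k|%:E * mu D)%E); first by rewrite lte_mul_pinfty.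
exact: (integral_cst mu mD `|k|%:E).
Qed.

Lemma sqintegrable_bounded G b : cmeasurable G ->
  (forall x, D x -> normc (G x) <= b) -> sqintegrable G.
Proof.
move=> mG Gb.
apply: (sqintegrable_dom mG (integrable_cst_ltoo (b ^+ 2))) => x Dx.
by rewrite lerXn2r// ?nnegrE ?normc_ge0 ?Gb// (le_trans (normc_ge0 _) (Gb _ Dx)).
Qed.

Lemma sqintegrable_integrable F : sqintegrable F -> cintegrable F.
Proof.
move=> iF; have i1 : sqintegrable (fun=> 1).
  by apply: (@sqintegrable_bounded _ 1); [exact: cmeasurable_cst|rewrite normc1].
by have := cintegrable_mul iF i1; under eq_fun do rewrite mulr1.
Qed.

End ComplexIntegral.
(** * Completeness of the space of square-integrable functions *)

Section RieszFischer.
Context d (T : measurableType d) (R : realType).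
Variables (mu : {measure set T -> \bar R}) (D : set T).
Hypotheses (mD : measurable D) (muD : (mu D < +oo)%E).

Lemma limn_einf_le (u : (\bar R)^nat) c :
  (forall n, u n <= c)%E -> (limn_einf u <= c)%E.
Proof.
move=> uc; rewrite limn_einf_lim; apply: lime_le; first exact: is_cvg_einfs.
by apply: nearW => n; apply: le_trans (uc n); apply: ereal_inf_lbound; exists n => /=.
Qed.

Lemma cvg_EFin_seq (u : R^nat) l :
  u @ \oo --> l -> (fun n => (u n)%:E) @ \oo --> l%:E.
Proof. by move=> ul; apply: cvg_EFin => //; apply: nearW. Qed.

Lemma cvg_of_summable_increments (u : R^nat) :
  (\sum_(n <oo) `|u n.+1 - u n|%:E < +oo)%E -> cvgn u.
Proof.
move=> fin.
have -> : u = (fun n => u 0 + series (telescope u) n).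
  by apply/funext => n; rewrite [LHS]eq_sum_telescope.
apply: is_cvgD; first exact: is_cvg_cst.
pose v n := \sum_(0 <= k < n) `|u k.+1 - u k|.
have cv : cvgn v.
  apply: nondecreasing_is_cvgn.
    by apply/nondecreasing_seqP => n; rewrite /v big_nat_recr//= lerDl.
  have fn : (\sum_(n <oo) `|u n.+1 - u n|%:E)%E \is a fin_num.
    by rewrite ge0_fin_numE//; exact: nneseries_ge0.
  exists (fine (\sum_(n <oo) `|u n.+1 - u n|%:E)%E) => _ [n _ <-].
  rewrite -lee_fin fineK// /v -sumEFin.
  exact: nneseries_lim_ge.
exact: normed_cvg.
Qed.

(** The increments of a rapidly Cauchy sequence are summable in mean, because
    $2a\le 2^{-n}+2^na^2$ and $D$ has finite measure; hence the sequence
    converges almost everywhere, and Fatou's lemma transfers the Cauchy bound to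
    the limit. *)
Lemma rapidly_cauchy_limit (s : nat -> T -> R) :
  (forall n, measurable_fun D (s n)) ->
  (forall n m, (n <= m)%N ->
    \int[mu]_(x in D) ((s m x - s n x) ^+ 2)%:E <= (4 ^- n)%:E)%E ->
  exists2 g : T -> R, measurable_fun D g &
  (forall n, \int[mu]_(x in D) ((g x - s n x) ^+ 2)%:E <= (4 ^- n)%:E)%E.
Proof.
move=> ms hs.
pose a n x : R := `|s n.+1 x - s n x|.
have ma n : measurable_fun D (fun x => (a n x)%:E).
  apply/measurable_EFinP; apply: measurableT_comp => //.
  exact: measurable_funB.
have a0 n x : D x -> (0 <= (a n x)%:E)%E by rewrite lee_fin /a.
have ia n : (\int[mu]_(x in D) (a n x)%:E <= (2 ^- n)%:E * (mu D + 1))%E.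
  apply: (@le_trans _ _ (\int[mu]_(x in D)
     ((2 ^- n)%:E + (2 ^+ n)%:E * ((s n.+1 x - s n x) ^+ 2)%:E))%E).
    have msq : measurable_fun D (fun x => ((s n.+1 x - s n x) ^+ 2)%:E).
      by apply/measurable_EFinP; apply: measurable_funX; exact: measurable_funB.
    apply: ge0_le_integral => //.
    - by move=> x; exact: a0.
    - apply: emeasurable_funD => //; exact: emeasurable_funM.
    move=> x Dx; rewrite -EFinM -EFinD lee_fin /a -(real_normK (num_real (_ - _))).
    set y := `|_|; have y0 : 0 <= y by exact: normr_ge0.
    have p0 : 0 < 2 ^+ n :> R by rewrite exprn_gt0.
    have q0 : 0 < 2 ^- n :> R by rewrite invr_gt0.
    have pq : 2 ^+ n * 2 ^- n = 1 :> R by rewrite mulfV// gt_eqF.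
    have : 0 <= 2 ^- n * (1 - 2 ^+ n * y) ^+ 2 by rewrite mulr_ge0 ?sqr_ge0// ltW.
    rewrite (_ : _ * _ ^+ 2 = 2 ^- n - 2 * (2 ^+ n * 2 ^- n) * y +
      2 ^+ n * (2 ^+ n * 2 ^- n) * y ^+ 2); last by ring.
    rewrite pq; lra.
  have msq : measurable_fun D (fun x => ((s n.+1 x - s n x) ^+ 2)%:E).
    by apply/measurable_EFinP; apply: measurable_funX; exact: measurable_funB.
  have sq0 x : D x -> (0 <= ((s n.+1 x - s n x) ^+ 2)%:E)%E.
    by rewrite lee_fin sqr_ge0.
  rewrite ge0_integralD//; last 2 first.
  - by move=> x Dx; rewrite mule_ge0// ?sq0// lee_fin exprn_ge0.
  - exact: emeasurable_funM.
  rewrite integral_cst// ge0_integralZl_EFin// ?exprn_ge0//.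
  rewrite (_ : (2 ^- n)%:E * (mu D + 1) = (2 ^- n)%:E * mu D + (2 ^- n)%:E)%E; last first.
    by rewrite ge0_muleDr ?mule1.
  rewrite leeD2l//.
  apply: (@le_trans _ _ ((2 ^+ n)%:E * (4 ^- n)%:E)%E).
    by rewrite lee_wpmul2l ?lee_fin ?exprn_ge0// hs.
  rewrite -EFinM lee_fin.
  have -> : 4 = 2 * 2 :> R by ring.
  by rewrite exprMn invfM mulrA mulfV ?mul1r// expf_neq0.
have sumfin : (\int[mu]_(x in D) \sum_(n <oo) (a n x)%:E < +oo)%E.
  rewrite integral_nneseries//.
  apply: (@le_lt_trans _ _ (\sum_(n <oo) (2 ^- n)%:E * (mu D + 1))%E).
    by apply: lee_nneseries => n *; [apply: integral_ge0 => x Dx; exact: a0|exact: ia].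
  have muf : mu D \is a fin_num by rewrite ge0_fin_numE.
  rewrite -(fineK muf) -EFinD.
  under eq_eseriesr do rewrite -EFinM mulrC.
  have := @cvg_geometric_eseries_half R ((fine (mu D) + 1) * 2) 0.
  move/cvg_lim => /(_ (@ereal_hausdorff R)).
  rewrite (_ : (\sum_(i <oo) _ )%E =
    (\sum_(i <oo) ((fine (mu D) + 1) * 2 / (2 ^ (i + 1))%:R)%:E)%E); last first.
    apply: eq_eseriesr => i _; congr EFin.
    rewrite addn1 natrX exprS invfM mulrA.
    by rewrite -[X in _ = X * _]mulrA mulfV ?mulr1// gt_eqF.
  by rewrite /eseries => ->; exact: ltry.
have msum : measurable_fun D (fun x => \sum_(n <oo) (a n x)%:E)%E.
  apply: (@ge0_emeasurable_sum _ _ _ D (fun n x => (a n x)%:E) xpredT) => //.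
  by move=> k x Dx _; exact: a0.
have isum : mu.-integrable D (fun x => \sum_(n <oo) (a n x)%:E)%E.
  apply/integrableP; split => //.
  rewrite (eq_integral (fun x => \sum_(n <oo) (a n x)%:E)%E)//.
  move=> x /set_mem Dx; rewrite gee0_abs//; apply: nneseries_ge0 => n _ _.
  exact: a0.
have cvgs : {ae mu, forall x, D x -> cvgn (s ^~ x)}.
  apply: filterS (integrable_ae mD isum) => x + Dx => /(_ Dx) fx.
  apply: cvg_of_summable_increments.
  by rewrite -ge0_fin_numE//; exact: nneseries_ge0.
pose g x := fine (limn_esup (fun n => (s n x)%:E)).
have mg : measurable_fun D g.
  apply: measurableT_comp => //; apply: measurable_fun_limn_esup => n.
  exact/measurable_EFinP.
have gE x : cvgn (s ^~ x) -> s ^~ x @ \oo --> g x.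
  move=> cx; have cx' : (fun n => (s n x)%:E) @ \oo --> (limn (s ^~ x))%:E.
    exact: cvg_EFin_seq.
  rewrite /g is_cvg_limn_esupE; last by apply/cvg_ex; eexists; exact: cx'.
  by rewrite (cvg_lim _ cx').
exists g => // n.
have mf k : measurable_fun D (fun x => ((s (k + n)%N x - s n x) ^+ 2)%:E).
  by apply/measurable_EFinP/measurable_funX; exact: measurable_funB.
rewrite (@ae_eq_integral _ _ _ mu D (fun x =>
   limn_einf (fun k => ((s (k + n)%N x - s n x) ^+ 2)%:E)) _ mD); last 3 first.
- by apply/measurable_EFinP/measurable_funX; exact: measurable_funB.
- rewrite (_ : (fun x => _) = (fun x =>
    - limn_esup (fun k => - ((s (k + n)%N x - s n x) ^+ 2)%:E))%E); last first.
    apply/funext => x; rewrite -limn_einfN; congr limn_einf.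
    by apply/funext => k; rewrite [RHS]/= opprK.
  apply: measurableT_comp => //; apply: measurable_fun_limn_esup => k.
  exact: measurableT_comp.
- apply: filterS cvgs => x + Dx => /(_ Dx) /gE cx.
  have c2 : (fun k => ((s (k + n)%N x - s n x) ^+ 2)%:E) @ \oo -->
      ((g x - s n x) ^+ 2)%:E.
    apply: cvg_EFin_seq.
    have c1 : (fun k => s (k + n)%N x - s n x) @ \oo --> g x - s n x.
      apply: cvgB; last exact: cvg_cst.
      by rewrite -(cvg_shiftn n) in cx.
    exact: (cvgM c1 c1).
  by have [-> _] := cvg_limn_einf_sup c2.
apply: le_trans (fatou mu mD mf _) _.
  by move=> k x _; rewrite lee_fin sqr_ge0.
by apply: limn_einf_le => k; apply: hs; rewrite leq_addl.
Qed.

End RieszFischer.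
(** * Orthonormal systems: Bessel, Riesz-Fischer, Parseval *)

Section EsumFset.
Variables (R : realType) (I : choiceType).
Implicit Types (a : I -> R) (A B : {fset I}).

Lemma fset_sum_le_esum a B : (forall i, 0 <= a i) ->
  ((\sum_(i <- B) a i)%:E <= \esum_(i in [set: I]) (a i)%:E)%E.
Proof.
move=> a0; apply: esum_ge; exists [set` B] => //.
by rewrite fsbig_finite//= set_fsetK sumEFin.
Qed.

Lemma esum_le_fset a (M : \bar R) :
  (forall B, (\sum_(i <- B) a i)%:E <= M)%E ->
  (\esum_(i in [set: I]) (a i)%:E <= M)%E.
Proof.
move=> aM; apply: ge_ereal_sup => _ [X [fX _] <-].
by rewrite fsbig_finite// sumEFin.
Qed.

Lemma ler_sum_fset a A B : (forall i, 0 <= a i) -> (A `<=` B)%fset ->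
  \sum_(i <- A) a i <= \sum_(i <- B) a i.
Proof.
move=> a0 AB; rewrite -lee_fin -!sumEFin.
have E (X : {fset I}) :
    (\sum_(i <- X) (a i)%:E = \sum_(i \in [set` X]) (a i)%:E)%E.
  by rewrite fsbig_finite//= set_fsetK.
rewrite (E A) (E B); apply: lee_fsum_nneg_subset => //.
  by move=> x; rewrite !inE => /= /(fsubsetP AB).
by move=> t _; rewrite lee_fin.
Qed.

Lemma esumZl a c : 0 < c -> (forall i, 0 <= a i) ->
  (\esum_(i in [set: I]) (c * a i)%:E = c%:E * \esum_(i in [set: I]) (a i)%:E)%E.
Proof.
move=> c0 a0.
have le_scale k (b : I -> R) : 0 <= k -> (forall i, 0 <= b i) ->
    (\esum_(i in [set: I]) (k * b i)%:E
     <= k%:E * \esum_(i in [set: I]) (b i)%:E)%E.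
  move=> k0 b0; apply: esum_le_fset => B.
  by rewrite -mulr_sumr EFinM lee_wpmul2l ?lee_fin// fset_sum_le_esum.
apply/eqP; rewrite eq_le le_scale ?(ltW c0)//=.
have := @le_scale c^-1 (fun i => c * a i).
under eq_esum do rewrite mulrA mulVf ?gt_eqF// mul1r.
rewrite invr_ge0 => /(_ (ltW c0)) h.
have /h : forall i, 0 <= c * a i by move=> i; rewrite mulr_ge0// ltW.
move=> /(@lee_wpmul2l _ c%:E); rewrite lee_fin ltW// => /(_ isT).
by rewrite muleA -EFinM mulfV ?gt_eqF// mul1e.
Qed.

Lemma esum_approx a (e : R) : (forall i, 0 <= a i) ->
  (\esum_(i in [set: I]) (a i)%:E < +oo)%E -> 0 < e ->
  exists A, fine (\esum_(i in [set: I]) (a i)%:E) - e <= \sum_(i <- A) a i.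
Proof.
move=> a0 fin e0.
have fn : \esum_(i in [set: I]) (a i)%:E \is a fin_num.
  by rewrite ge0_fin_numE//; apply: esum_ge0 => i _; rewrite lee_fin.
have [_ [X [fX _] <-]] := ub_ereal_sup_adherent e0 fn.
rewrite fsbig_finite// sumEFin => h; exists (fset_set X).
by rewrite -lee_fin EFinB fineK//; exact: ltW.
Qed.

End EsumFset.

Section OrthonormalSystem.
Context d (T : measurableType d) (R : realType).
Variables (mu : {measure set T -> \bar R}) (D : set T).
Hypotheses (mD : measurable D) (muD : (mu D < +oo)%E).
Variables (I : choiceType) (e : I -> T -> R[i]).
Local Notation C := R[i].
Local Notation Re := (@complex.Re R).
Local Notation Im := (@complex.Im R).
Local Notation sqint := (sqintegrable mu D).
Local Notation norm2 := (sqnorm mu D).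
Local Notation ip := (inner mu D).

Definition orthonormal_system := (forall i, sqint (e i)) /\
  (forall i j, (ip (e i) (e j)) = (i == j)%:R).

Definition partial (u : I -> C) (B : {fset I}) (x : T) : C :=
  \sum_(l <- B) u l * e l x.

(** [F] is the sum of the unconditionally convergent series $\sum_l u_le_l$. *)
Definition represents (u : I -> C) (F : T -> C) := sqint F /\
  forall eps : R, 0 < eps -> exists A : {fset I}, forall B : {fset I},
    (A `<=` B)%fset -> norm2 (fun x => F x - partial u B x) <= eps.

Definition total_system := forall F, sqint F ->
  (forall i, (ip F (e i)) = 0) -> norm2 F = 0.

Hypothesis onb : orthonormal_system.
Implicit Types (u : I -> C) (F : T -> C) (A B : {fset I}).

Let e_sq i : sqint (e i). Proof. exact: onb.1. Qed.

Lemma partial_sq u B : sqint (partial u B).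
Proof. by apply: sqintegrable_sum => // i; exact: sqintegrableZl. Qed.

Lemma inner_partial_e u B j : j \in B -> (ip (partial u B) (e j)) = u j.
Proof.
move=> jB; rewrite inner_suml//; last by move=> i; exact: sqintegrableZl.
under eq_bigr do rewrite innerZl// onb.2.
rewrite (bigD1_seq j)//= eqxx mulr1 big1 ?addr0// => i /negPf ->.
by rewrite mulr0.
Qed.

Lemma inner_partial u B F : sqint F ->
  (ip F (partial u B)) = \sum_(l <- B) (u l)^* * (ip F (e l)).
Proof.
move=> iF; rewrite (innerJ mD (partial_sq u B) iF) inner_suml//; last first.
  by move=> i; exact: sqintegrableZl.
rewrite conjc_sum; apply: eq_bigr => l _.
by rewrite innerZl// conjcM (innerJ mD iF (e_sq l)) conjcK.
Qed.

Lemma norm2B_partial u B F : sqint F ->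
  norm2 (fun x => F x - partial u B x) = norm2 F
    - 2 * \sum_(l <- B) Re ((u l)^* * (ip F (e l))) + \sum_(l <- B) normc (u l) ^+ 2.
Proof.
move=> iF; rewrite sqnormB//; last exact: partial_sq.
rewrite inner_partial// cRe_sum; congr (_ + _).
have : (norm2 (partial u B))%:C = (\sum_(l <- B) normc (u l) ^+ 2)%:C.
  rewrite -inner_norm// inner_partial; last exact: partial_sq.
  rewrite rmorph_sum !big_seq; apply: eq_bigr => l lB.
  by rewrite inner_partial_e// mulrC mulcJ.
by move/complexI.
Qed.

Lemma norm2B_partial_coef u B F : sqint F ->
  (forall l, l \in B -> (ip F (e l)) = u l) ->
  norm2 (fun x => F x - partial u B x) = norm2 F - \sum_(l <- B) normc (u l) ^+ 2.
Proof.
move=> iF Fu; rewrite norm2B_partial// [X in _ - 2 * X](_ : _ =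
    \sum_(l <- B) normc (u l) ^+ 2); first by ring.
rewrite !big_seq; apply: eq_bigr => l lB.
by rewrite Fu// mulrC mulcJ.
Qed.

Lemma bessel F B : sqint F -> \sum_(l <- B) normc (ip F (e l)) ^+ 2 <= norm2 F.
Proof.
move=> iF; rewrite -subr_ge0.
by rewrite -(@norm2B_partial_coef (fun l => (ip F (e l))))// sqnorm_ge0.
Qed.

Lemma bessel1 F l : sqint F -> normc (ip F (e l)) ^+ 2 <= norm2 F.
Proof. by move=> /(bessel [fset l]%fset); rewrite big_seq_fset1. Qed.

(** The coefficient at [l] of [F] minus a partial sum containing [l] is bounded by
    the norm of that difference, which is arbitrarily small. *)
Lemma represents_coef u F l : represents u F -> (ip F (e l)) = u l.
Proof.
move=> [iF uF]; apply/eqP; rewrite -subr_eq0 -normc_eq0 -sqrf_eq0.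
rewrite eq_le sqr_ge0 andbT; apply/ler_addgt0Pr => eps eps0; rewrite add0r.
have [A AB] := uF _ eps0.
apply: le_trans (AB (A `|` [fset l])%fset _); last exact: fsubsetUl.
have lB : l \in (A `|` [fset l])%fset by rewrite !inE eqxx orbT.
rewrite -{1}(inner_partial_e u lB) -innerBl//; last exact: partial_sq.
by apply: bessel1; apply: sqintegrableB => //; exact: partial_sq.
Qed.

Lemma represents_norm u F : represents u F ->
  (\esum_(l in [set: I]) (normc (u l) ^+ 2)%:E = (norm2 F)%:E)%E.
Proof.
move=> uF; have [iF cF] := uF; have coefE l := represents_coef l uF.
apply/eqP; rewrite eq_le; apply/andP; split.
  apply: esum_le_fset => B; rewrite lee_fin.
  by under eq_bigr do rewrite -coefE; exact: bessel.
apply/lee_addgt0Pr => eps eps0; have [A /(_ _ (fsubset_refl A))] := cF _ eps0.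
rewrite norm2B_partial_coef// lerBlDr => h.
apply: (@le_trans _ _ (eps + \sum_(l <- A) normc (u l) ^+ 2)%:E).
  by rewrite lee_fin.
rewrite EFinD addeC leeD2r//; apply: fset_sum_le_esum => l.
exact: sqr_ge0.
Qed.

Lemma norm2_partialB u A B : (A `<=` B)%fset ->
  norm2 (fun x => partial u B x - partial u A x) =
  \sum_(l <- B) normc (u l) ^+ 2 - \sum_(l <- A) normc (u l) ^+ 2.
Proof.
move=> AB; have i0 : sqint (fun=> 0) by exact: sqintegrable0.
rewrite norm2B_partial_coef; [|exact: partial_sq|]; last first.
  by move=> l /(fsubsetP AB); exact: inner_partial_e.
congr (_ - _); have := @norm2B_partial_coef u B (partial u B) (partial_sq u B).
move=> /(_ (fun l => @inner_partial_e u B l)) /esym.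
have -> : norm2 (fun x => partial u B x - partial u B x) = 0.
  rewrite -[RHS](mul0r (fine (mu D))) -Rintegral_cst//.
  by apply: eq_Rintegral => x _; rewrite subrr normc0 expr0n.
by move/eqP; rewrite subr_eq0 => /eqP.
Qed.

Lemma sqnormB_le F G : sqint F -> sqint G ->
  norm2 (fun x => F x - G x) <= 2 * norm2 F + 2 * norm2 G.
Proof.
move=> iF iG; have := sqnormD_le mD iF (sqintegrableN mD iG).
congr (_ <= _ + 2 * _); rewrite /sqnorm.
by apply: eq_Rintegral => x _; rewrite normc_opp.
Qed.

Lemma exp4_small (eps : R) : 0 < eps -> exists n, 6 * 4 ^- n <= eps.
Proof.
move=> eps0; have e6 : 0 <= 6 / eps by rewrite divr_ge0// ltW.
have := archi_boundP e6; set n := Num.bound _ => hn; exists n.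
have p4 : 0 < 4 ^+ n :> R by rewrite exprn_gt0.
rewrite ler_pdivrMr// mulrC -ler_pdivrMr// (le_trans (ltW hn))//.
by rewrite -natrX ler_nat ltnW// ltn_expl.
Qed.

(** The partial sums over an exhausting sequence of finite index sets, chosen so
    that the remaining coefficients have square sum at most $4^{-n}$, are
    rapidly Cauchy in the real and in the imaginary part. *)
Theorem riesz_fischer u :
  (\esum_(l in [set: I]) (normc (u l) ^+ 2)%:E < +oo)%E ->
  exists F, represents u F.
Proof.
move=> ufin; set S := fine (\esum_(l in [set: I]) (normc (u l) ^+ 2)%:E).
have u0 l : 0 <= normc (u l) ^+ 2 by exact: sqr_ge0.
have p4 n : 0 < 4 ^- n :> R by rewrite invr_gt0 exprn_gt0.
have /choice[A hA] n : exists A, S - 4 ^- n <= \sum_(l <- A) normc (u l) ^+ 2.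
  by apply: esum_approx.
pose B := fix B n := if n is m.+1 then (A n `|` B m)%fset else A 0.
have AB n : (A n `<=` B n)%fset by case: n => //= n; exact: fsubsetUl.
have Bmono n m : (n <= m)%N -> (B n `<=` B m)%fset.
  elim: m => [|m IH]; first by rewrite leqn0 => /eqP ->.
  rewrite leq_eqVlt => /predU1P[->//|]; rewrite ltnS => /IH h /=.
  exact/(fsubset_trans h)/fsubsetUr.
have sumS (X : {fset I}) : \sum_(l <- X) normc (u l) ^+ 2 <= S.
  have fn : (\esum_(l in [set: I]) (normc (u l) ^+ 2)%:E)%E \is a fin_num.
    by rewrite ge0_fin_numE//; apply: esum_ge0 => l _; rewrite lee_fin.
  by rewrite -lee_fin fineK// fset_sum_le_esum.
have tail n X : (B n `<=` X)%fset ->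
    norm2 (fun x => partial u X x - partial u (B n) x) <= 4 ^- n.
  move=> BX; rewrite norm2_partialB//.
  have := ler_sum_fset u0 (AB n); have := hA n; have := sumS X; lra.
pose s n := partial u (B n).
have ms n : cmeasurable D (s n) := (partial_sq u (B n)).1.
have part (f : C -> R) : (forall z w, f (z - w) = f z - f w) ->
    (forall z, f z ^+ 2 <= normc z ^+ 2) ->
    (forall n, measurable_fun D (fun x => f (s n x))) ->
    exists2 g : T -> R, measurable_fun D g & forall n,
      (\int[mu]_(x in D) ((g x - f (s n x)) ^+ 2)%:E <= (4 ^- n)%:E)%E.
  move=> fB fle mf; apply: rapidly_cauchy_limit => // n m nm.
  apply: le_trans (_ : ((norm2 (fun x => s m x - s n x))%:E <= _)%E); last first.
    by rewrite lee_fin tail// Bmono.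
  have isq : sqint (fun x => s m x - s n x).
    by apply: sqintegrableB => //; exact: partial_sq.
  rewrite -sqnormE//; apply: ge0_le_integral => //.
  - by move=> x _; rewrite lee_fin sqr_ge0.
  - by apply/measurable_EFinP/measurable_funX; exact: measurable_funB.
  - by apply/measurable_EFinP; exact: measurable_normc2 isq.1.
  - by move=> x _; rewrite lee_fin -fB.
have [g1 mg1 hg1] : exists2 g : T -> R, measurable_fun D g & forall n,
      (\int[mu]_(x in D) ((g x - Re (s n x)) ^+ 2)%:E <= (4 ^- n)%:E)%E.
  apply: part => [z w|z|n]; last exact: (ms n).1.
    by rewrite cReD cReN.
  by rewrite normc2E lerDl sqr_ge0.
have [g2 mg2 hg2] : exists2 g : T -> R, measurable_fun D g & forall n,
      (\int[mu]_(x in D) ((g x - Im (s n x)) ^+ 2)%:E <= (4 ^- n)%:E)%E.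
  apply: part => [z w|z|n]; last exact: (ms n).2.
    by rewrite cImD cImN.
  by rewrite normc2E lerDr sqr_ge0.
pose F x := g1 x +i* g2 x.
have mFs n : cmeasurable D (fun x => F x - s n x) by apply: cmeasurableB.
have hF n : (\int[mu]_(x in D) (normc (F x - s n x) ^+ 2)%:E
    <= (2 * 4 ^- n)%:E)%E.
  rewrite (eq_integral (fun x => ((g1 x - Re (s n x)) ^+ 2)%:E +
      ((g2 x - Im (s n x)) ^+ 2)%:E)%E); last first.
    by move=> x _; rewrite normc2E cReD cReN cImD cImN.
  rewrite ge0_integralD//.
  - have -> : 2 * 4 ^- n = 4 ^- n + 4 ^- n :> R by ring.
    by rewrite EFinD leeD.
  - by move=> x _; rewrite lee_fin sqr_ge0.
  - apply/measurable_EFinP/measurable_funX.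
    by apply: measurable_funB => //; exact: (ms n).1.
  - by move=> x _; rewrite lee_fin sqr_ge0.
  - apply/measurable_EFinP/measurable_funX.
    by apply: measurable_funB => //; exact: (ms n).2.
have iFs n : sqint (fun x => F x - s n x).
  split => //; apply/integrableP; split.
    by apply/measurable_EFinP; exact: measurable_normc2.
  under eq_integral do rewrite /= ger0_norm ?sqr_ge0//.
  exact: le_lt_trans (hF n) (ltry _).
have iF : sqint F.
  have := sqintegrableD mD (iFs 0) (partial_sq u (B 0)).
  by under eq_fun do rewrite subrK.
exists F; split => // eps /exp4_small[n hn]; exists (B n) => X BX.
apply: le_trans hn.
have -> : norm2 (fun x => F x - partial u X x) =
    norm2 (fun x => (F x - s n x) - (partial u X x - s n x)).
  by apply: eq_sqnorm => x _; rewrite opprB addrA subrK.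
apply: le_trans (sqnormB_le _ _) _ => //.
  by apply: sqintegrableB => //; exact: partial_sq.
have h1 : norm2 (fun x => F x - s n x) <= 2 * 4 ^- n.
  by rewrite -lee_fin -sqnormE.
have := tail n X BX; rewrite -/(s n); lra.
Qed.

Hypothesis tot : total_system.

(** The sum $G$ of the Fourier series of $F$ exists by Riesz-Fischer, and $F-G$ is
    orthogonal to the system. *)
Theorem fourier_series_represents F : sqint F -> represents (fun l => (ip F (e l))) F.
Proof.
move=> iF; have [G repG] : exists G, represents (fun l => (ip F (e l))) G.
  apply: riesz_fischer; apply: (@le_lt_trans _ _ (norm2 F)%:E); last exact: ltry.
  by apply: esum_le_fset => B; rewrite lee_fin; exact: bessel.
have iG := repG.1.
have FG0 : norm2 (fun x => F x - G x) = 0.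
  apply: tot; first exact: sqintegrableB.
  by move=> l; rewrite innerBl// (represents_coef l repG) subrr.
split => // eps eps0; have eps2 : 0 < eps / 2 by rewrite divr_gt0.
have [A hA] := repG.2 _ eps2; exists A => B /hA hB.
have -> : norm2 (fun x => F x - partial (fun l => (ip F (e l))) B x) =
    norm2 (fun x => (F x - G x) + (G x - partial (fun l => (ip F (e l))) B x)).
  by apply: eq_sqnorm => x _; rewrite addrA subrK.
apply: le_trans (sqnormD_le _ _ _) _ => //; first exact: sqintegrableB.
  by apply: sqintegrableB => //; exact: partial_sq.
rewrite FG0; lra.
Qed.

Lemma representsP u F :
  represents u F <-> sqint F /\ (forall l, (ip F (e l)) = u l).
Proof.
split=> [repF|[iF Fu]].
  by split => [|l]; [exact: repF.1|exact: represents_coef].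
rewrite (_ : u = fun l => ip F (e l)); last exact/funext.
exact: fourier_series_represents.
Qed.

Theorem parseval F : sqint F ->
  (\esum_(l in [set: I]) (normc (ip F (e l)) ^+ 2)%:E = (norm2 F)%:E)%E.
Proof. by move=> iF; apply: represents_norm; exact: fourier_series_represents. Qed.

End OrthonormalSystem.
(** * Tilings by translates and integrals *)

Section Translation.
Variable R : realType.
Local Notation mu := (@lebesgue_measure R).
Local Notation TR := (measurableTypeR R).
Implicit Types (D E : set TR) (s : R).

Lemma measurable_translation s D : measurable_fun D (fun x : R => x + s).
Proof. by apply: measurable_funD. Qed.

(** Both sides are measures that agree on half-open intervals. *)
Lemma lebesgue_measure_translate s D : measurable D ->
  pushforward mu ((fun x => x + s) : R -> measurableTypeR R) D = mu D.
Proof.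
move=> mD.
have mf : measurable_fun [set: R] ((fun x => x + s) : R -> measurableTypeR R).
  exact: measurable_translation.
apply/esym.
apply: (@lebesgue_measure_unique _ (pushforward mu
  ((fun x => x + s) : R -> measurableTypeR R))) => //= _ [[a b]] _ <-.
rewrite /pushforward [X in mu X = _](_ : _ = [set` `]a, b]])//.
rewrite (_ : _ @^-1` _ = [set` `]a - s, b - s]]); last first.
  by apply/seteqP; split=> x /=; rewrite !in_itv/= ltrBlDr lerBrDr.
rewrite !lebesgue_measure_itv/= !lte_fin ltrD2r; case: ifP => // _.
by rewrite -!EFinB; congr EFin; ring.
Qed.

Lemma ge0_integral_translate s D (f : R -> \bar R) : measurable D ->
  measurable_fun D f -> (forall x, D x -> 0 <= f x)%E ->
  (\int[mu]_(x in (fun x => (x + s)%R) @^-1` D) f (x + s)%R = \int[mu]_(x in D) f x)%E.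
Proof.
move=> mD mf f0.
have mt : measurable_fun [set: measurableTypeR R]
    ((fun x => x + s) : measurableTypeR R -> measurableTypeR R).
  exact: measurable_translation.
have f0' : {in D, forall y, (0 <= f y)%E} by move=> x /set_mem/f0.
rewrite -[LHS](ge0_integral_pushforward mt mu mD mf f0').
apply: eq_measure_integral => A mA AD.
exact: lebesgue_measure_translate.
Qed.

Lemma integral_translate s D (f : R -> \bar R) : measurable D ->
  measurable_fun D f ->
  (\int[mu]_(x in (fun x => (x + s)%R) @^-1` D) f (x + s)%R = \int[mu]_(x in D) f x)%E.
Proof.
move=> mD mf; rewrite integralE [RHS]integralE; congr (_ - _)%E.
  rewrite -(ge0_integral_translate s mD (measurable_funepos mf)) => [|x _].
    by apply: eq_integral => x _; rewrite !funeposE.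
  exact: funepos_ge0.
rewrite -(ge0_integral_translate s mD (measurable_funeneg mf)) => [|x _].
  by apply: eq_integral => x _; rewrite !funenegE.
exact: funeneg_ge0.
Qed.

End Translation.

Section Tiling.
Variable R : realType.
Local Notation mu := (@lebesgue_measure R).
Local Notation TR := (measurableTypeR R).
Local Notation C := R[i].
Implicit Types (D E : set TR).

Definition tiling K (s : 'I_K -> R) E D := [/\
  forall i x, E x -> D (x + s i),
  forall y, D y -> exists i, E (y - s i) &
  forall i j y, E (y - s i) -> E (y - s j) -> i = j].

Variables (K : nat) (s : 'I_K -> R) (E D : set TR).
Hypotheses (mE : measurable E) (mD : measurable D) (tile : tiling s E D).

Lemma tiling_measurable_fun d' (Y : sigmaRingType d') (f : TR -> Y) i :
  measurable_fun D f -> measurable_fun E (fun x => f (x + s i)).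
Proof.
move=> mf; apply: (measurable_comp (F := D)) => //.
  by move=> _ [x Ex <-]; case: tile => + _ _; exact.
exact: measurable_translation.
Qed.

Lemma tiling_integral (f : TR -> R) : measurable_fun D f ->
  (\int[mu]_(x in D) (f x)%:E = \sum_(i < K) \int[mu]_(x in E) (f (x + s i)%R)%:E)%E.
Proof.
move=> mf; case: tile => t1 t2 t3.
pose P i : set TR := (fun x : TR => x - s i) @^-1` E.
have mP i : measurable (P i).
  rewrite /P -[X in measurable X]setTI.
  exact: (measurable_translation (- s i)).
have PE i : (fun x => x + s i) @^-1` P i = E.
  by apply/seteqP; split=> x; rewrite /P /= addrK.
have PD i : P i `<=` D.
  by move=> x Px; have := t1 i _ Px; rewrite subrK.
have DE : D = \big[setU/set0]_(i <- index_enum 'I_K) P i.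
  apply/seteqP; split => [y /t2[i Ei]|y]; rewrite -bigcup_seq; last first.
    by move=> [i _ Pi]; exact: PD Pi.
  by exists i => //=; rewrite mem_index_enum.
rewrite {1}DE integral_bigsetU_EFin//.
- apply: eq_bigr => i _.
  rewrite -(@integral_translate _ (s i) (P i) (EFin \o f))// ?PE//.
  by apply/measurable_EFinP; exact: measurable_funS mf.
- exact: index_enum_uniq.
- move=> i j _ _ [y [Pi Pj]]; exact: t3 Pi Pj.
- by rewrite -DE; exact/measurable_EFinP.
Qed.

Lemma tiling_integrable (f : TR -> R) i : mu.-integrable D (EFin \o f) ->
  mu.-integrable E (EFin \o (fun x => f (x + s i))).
Proof.
move=> /integrableP[/measurable_EFinP mf fi]; apply/integrableP; split.
  by apply/measurable_EFinP; exact: tiling_measurable_fun.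
apply: le_lt_trans fi.
have mnf : measurable_fun D (fun x => `|f x|) by exact: measurableT_comp.
rewrite [leRHS](_ : _ = \int[mu]_(x in D) (`|f x|)%:E)%E//.
rewrite tiling_integral//.
rewrite (bigD1 i)//= leeDl//; apply: sume_ge0 => j _.
by apply: integral_ge0 => x _; rewrite lee_fin.
Qed.

Lemma tiling_Rintegral (f : TR -> R) : mu.-integrable D (EFin \o f) ->
  \int[mu]_(x in D) f x = \sum_(i < K) \int[mu]_(x in E) f (x + s i).
Proof.
move=> fi; apply/EFin_inj; rewrite -sumEFin.
have mf : measurable_fun D f by apply/measurable_EFinP; exact: measurable_int fi.
rewrite fineK; last exact: integrable_fin_num fi.
rewrite tiling_integral//; apply: eq_bigr => i _.
by rewrite fineK//; apply: integrable_fin_num => //; exact: tiling_integrable.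
Qed.

Lemma tiling_cintegrable (F : TR -> C) i : cintegrable mu D F ->
  cintegrable mu E (fun x => F (x + s i)).
Proof.
move=> [F1 F2].
by split; [exact: (tiling_integrable i F1)|exact: (tiling_integrable i F2)].
Qed.

Lemma tiling_cint (F : TR -> C) : cintegrable mu D F ->
  cint mu D F = \sum_(i < K) cint mu E (fun x => F (x + s i)).
Proof.
by move=> [F1 F2]; apply: complexP; rewrite ?cRe_sum ?cIm_sum /=;
  rewrite tiling_Rintegral.
Qed.

Lemma tiling_cmeasurable (F : TR -> C) i : cmeasurable D F ->
  cmeasurable E (fun x => F (x + s i)).
Proof.
move=> [F1 F2]; split; first exact: (tiling_measurable_fun i F1).
exact: (tiling_measurable_fun i F2).
Qed.

Lemma tiling_sqintegrable (F : TR -> C) i : sqintegrable mu D F ->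
  sqintegrable mu E (fun x => F (x + s i)).
Proof.
move=> [F1 F2].
by split; [exact: tiling_cmeasurable|exact: (tiling_integrable i F2)].
Qed.

Lemma tiling_sqnorm (F : TR -> C) : sqintegrable mu D F ->
  sqnorm mu D F = \sum_(i < K) sqnorm mu E (fun x => F (x + s i)).
Proof. by move=> [_ F2]; rewrite /sqnorm tiling_Rintegral. Qed.

End Tiling.

Section SubdivideInterval.
Variable R : realType.
Implicit Types (h y : R) (K : nat).

Lemma subdivision_index h y K : 0 < h -> 0 <= y < K%:R * h ->
  exists i : 'I_K, 0 <= y - i%:R * h < h.
Proof.
move=> h0 /andP[y0 yK].
have q0 : 0 <= y / h by rewrite divr_ge0// ltW.
have /andP[t1 t2] := truncn_itv q0.
have tK : (Num.truncn (y / h) < K)%N.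
  by rewrite -(ltr_nat R) (le_lt_trans t1)// ltr_pdivrMr.
exists (Ordinal tK) => /=; rewrite subr_ge0 -ler_pdivlMr// t1/=.
by move: t2; rewrite ltr_pdivrMr// -natr1 mulrDl mul1r ltrBlDr addrC.
Qed.

Lemma subdivision_unique h y (i j : nat) : 0 < h ->
  0 <= y - i%:R * h < h -> 0 <= y - j%:R * h < h -> i = j.
Proof.
move=> h0; wlog suff H : i j /
    0 <= y - i%:R * h < h -> 0 <= y - j%:R * h < h -> (i <= j)%N.
  by move=> hi hj; apply/eqP; rewrite eqn_leq !H.
move=> /andP[i0 i1] /andP[j0 j1]; rewrite leqNgt; apply/negP => ji.
have : (j%:R + 1) * h <= i%:R * h by rewrite ler_pM2r// natr1 ler_nat.
lra.
Qed.

End SubdivideInterval.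
(** * Exponentials on an interval *)

Section Expi.
Variable R : realType.
Implicit Types (a b t : R).

Lemma expiD a b : expi (a + b) = expi a * expi b :> R[i].
Proof. by apply: complexP; rewrite ?cReM ?cImM /= ?cosD ?sinD // addrC. Qed.

Lemma expi0 : expi 0 = 1 :> R[i].
Proof. by rewrite /expi cos0 sin0. Qed.

Lemma expiN a : expi (- a) = (expi a)^*.
Proof. by rewrite /expi cosN sinN. Qed.

Lemma normc_expi a : normc (expi a) = 1.
Proof. by rewrite /= cos2Dsin2 sqrtr1. Qed.

Lemma expi_mulJ a : expi a * (expi a)^* = 1.
Proof. by rewrite mulcJ normc_expi expr1n. Qed.

Lemma expi_pi_nat n : expi (pi * n%:R) = (-1) ^+ n :> R[i].
Proof.
elim: n => [|n IH]; first by rewrite mulr0 expi0.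
rewrite -natr1 mulrDr mulr1 expiD IH exprSr; congr (_ * _).
by apply: complexP; rewrite /= ?cospi ?sinpi ?oppr0.
Qed.

Lemma conjc_sign n : ((-1) ^+ n)^* = (-1) ^+ n :> R[i].
Proof.
elim: n => [|n IH]; first by rewrite expr0; apply: complexP; rewrite /= ?oppr0.
rewrite exprS conjcM IH; congr (_ * _).
by apply: complexP; rewrite /= ?oppr0 ?opprK.
Qed.

Lemma expi_2pi_int (z : int) : expi (2 * pi * z%:~R) = 1 :> R[i].
Proof.
have nat_case n : expi (2 * pi * n%:R) = 1 :> R[i].
  rewrite (_ : 2 * pi * n%:R = pi * (2 * n)%:R); last by rewrite natrM; ring.
  by rewrite expi_pi_nat exprM sqrrN expr1n expr1n.
case: z => n; first exact: nat_case.
rewrite NegzE mulrNz mulrN expiN [_%:~R]/(n.+1%:R) nat_case.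
by apply: complexP; rewrite /= ?oppr0.
Qed.

Lemma expi_periodic a (z : int) : expi (a + 2 * pi * z%:~R) = expi a.
Proof. by rewrite expiD expi_2pi_int mulr1. Qed.

Lemma cmeasurable_expi (D : set (measurableTypeR R)) c :
  cmeasurable D (fun x => expi (c * x)).
Proof.
have mc : measurable_fun D (fun x : R => c * x) by exact: mulrl_measurable.
split.
  have ms := continuous_measurable_fun (@continuous_cos R).
  exact: (measurable_comp (F := setT) _ _ ms mc).
have ms := continuous_measurable_fun (@continuous_sin R).
exact: (measurable_comp (F := setT) _ _ ms mc).
Qed.

End Expi.

Section PeakFunctions.
Variable R : realType.
Implicit Types t y : R.

Lemma bernoulli_ge y N : 0 <= y <= 1 -> 1 - N%:R * y <= (1 - y) ^+ N.
Proof.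
move=> /andP[y0 y1]; elim: N => [|N IH]; first by rewrite mul0r subr0.
have p0 : 0 <= 1 - y by rewrite subr_ge0.
rewrite exprS -natr1; apply: le_trans (ler_wpM2l p0 IH).
have : 0 <= N%:R * y * y by rewrite !mulr_ge0.
nra.
Qed.

Lemma bernoulli_le y N : 0 <= y <= 1 -> (1 - y) ^+ N * (1 + N%:R * y) <= 1.
Proof.
move=> /andP[y0 y1]; elim: N => [|N IH]; first by rewrite mul0r addr0 mulr1.
have p0 : 0 <= (1 - y) ^+ N by rewrite exprn_ge0// subr_ge0.
apply: le_trans IH; rewrite exprSr -natr1 -mulrA ler_wpM2l//.
have : 0 <= N%:R * y * y by rewrite !mulr_ge0.
nra.
Qed.

(** On $[0,1]$ these polynomials in $t$ stay between $0$ and $1$ and converge to the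
    indicator function of $t<1/2$, except at $t=1/2$. *)
Definition peak n t : R := (1 - t ^+ n) ^+ (2 ^ n).

Lemma peak_itv n t : 0 <= t <= 1 -> 0 <= peak n t <= 1.
Proof.
move=> /andP[t0 t1]; rewrite /peak.
have /andP[h0 h1] : 0 <= t ^+ n <= 1 by rewrite exprn_ge0// exprn_ile1.
by rewrite exprn_ge0 ?subr_ge0//= exprn_ile1 ?subr_ge0// lerBlDr lerDl.
Qed.

(** $(1-t^n)^{2^n}\ge 1-(2t)^n$. *)
Lemma peak_cvg1 t : 0 <= t < 1 / 2 -> peak ^~ t @ \oo --> (1 : R).
Proof.
move=> /andP[t0 t2]; have t1 : t <= 1 by lra.
apply: (@squeeze_cvgr _ _ _ _ (fun n => 1 - (2 * t) ^+ n) (fun=> 1)).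
- apply: nearW => n; have /andP[_ ->] := peak_itv n (introT andP (conj t0 t1)).
  rewrite andbT; have := @bernoulli_ge (t ^+ n) (2 ^ n).
  by rewrite natrX -exprMn; apply; rewrite exprn_ge0//= exprn_ile1.
- rewrite -[X in _ --> X]subr0; apply: cvgB; first exact: cvg_cst.
  apply: cvg_expr; rewrite ger0_norm ?mulr_ge0//; lra.
- exact: cvg_cst.
Qed.

(** $(1-t^n)^{2^n}\le (1+(2t)^n)^{-1}\le (2t)^{-n}$. *)
Lemma peak_cvg0 t : 1 / 2 < t <= 1 -> peak ^~ t @ \oo --> (0 : R).
Proof.
move=> /andP[t2 t1]; have t0 : 0 <= t by lra.
have tt : 0 < 2 * t by lra.
apply: (@squeeze_cvgr _ _ _ _ (fun=> 0) (fun n => ((2 * t)^-1) ^+ n)).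
- apply: nearW => n; have /andP[p0 _] := peak_itv n (introT andP (conj t0 t1)).
  rewrite p0/= exprVn -[leRHS]mul1r ler_pdivlMr ?exprn_gt0//.
  have h : 0 <= t ^+ n <= 1 by rewrite exprn_ge0//= exprn_ile1.
  have := bernoulli_le (2 ^ n) h; rewrite natrX -exprMn -/(peak n t).
  by apply: le_trans; rewrite ler_wpM2l// lerDr.
- exact: cvg_cst.
- apply: cvg_expr; rewrite ger0_norm ?invr_ge0// ?ltW// invf_lt1//; lra.
Qed.

End PeakFunctions.

Section ExponentialsOnInterval.
Variables (R : realType) (L : R).
Hypothesis L0 : 0 < L.
Local Notation mu := (@lebesgue_measure R).
Local Notation D := (`[0, L[%classic : set (measurableTypeR R)).
Local Notation C := R[i].
Local Notation Re := (@complex.Re R).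
Local Notation Im := (@complex.Im R).

Definition wave (z : int) (x : R) : C := expi (2 * pi * z%:~R / L * x).

Let mD : measurable D. Proof. exact: measurable_itv. Qed.

Let muDE : mu D = L%:E.
Proof. by rewrite lebesgue_measure_itv/= lte_fin L0 sube0. Qed.

Let muD : (mu D < +oo)%E. Proof. by rewrite muDE ltry. Qed.

Lemma waveD z w x : wave (z + w) x = wave z x * wave w x.
Proof.
rewrite /wave -expiD; congr expi.
by rewrite intrD mulrDr !mulrDl.
Qed.

Lemma waveN z x : wave (- z) x = (wave z x)^*.
Proof. by rewrite /wave -expiN mulrNz mulrN !mulNr. Qed.

Lemma wave0 x : wave 0 x = 1.
Proof. by rewrite /wave mulr0z mulr0 !mul0r expi0. Qed.

Lemma cmeasurable_wave z : cmeasurable D (wave z).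
Proof. exact: cmeasurable_expi. Qed.

Lemma wave_sq z : sqintegrable mu D (wave z).
Proof.
apply: (@sqintegrable_bounded _ _ _ mu D mD muD _ 1); first exact: cmeasurable_wave.
by move=> x _; rewrite normc_expi.
Qed.

Lemma alternating_sum (J : C) m : \sum_(i < 2 * m) (-1) ^+ i * J = 0.
Proof.
elim: m => [|m IH]; first by rewrite muln0 big_ord0.
rewrite mulnS add2n !big_ord_recl /= expr0 expr1 mul1r mulN1r.
rewrite addrA subrr add0r -[RHS]IH; apply: eq_bigr => i _.
by rewrite /bump /= !add1n !exprS !mulN1r opprK.
Qed.

Lemma interval_tiling K : (0 < K)%N ->
  tiling (fun i : 'I_K => i%:R * (L / K%:R))
    (`[0, L / K%:R[%classic : set (measurableTypeR R)) D.
Proof.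
move=> K0; have K0' : 0 < K%:R :> R by rewrite ltr0n.
have h0 : 0 < L / K%:R by rewrite divr_gt0.
have KL : K%:R * (L / K%:R) = L by rewrite mulrC divfK// gt_eqF.
split=> [i x|y|i j y] /=; rewrite ?in_itv /=.
- move=> /andP[x0 xh]; rewrite addr_ge0// ?mulr_ge0// ?ltW//=.
  have : i.+1%:R * (L / K%:R) <= L by rewrite -[leRHS]KL ler_pM2r// ler_nat.
  rewrite -natr1; lra.
- by rewrite -{1}KL => /(subdivision_index h0)[i hi]; exists i; rewrite in_itv.
- by move=> hi hj; apply/ord_inj; exact: (subdivision_unique h0 hi hj).
Qed.

(** The interval splits into $2|z|$ translates of one piece, and each translation
    changes the sign of the exponential. *)
Lemma cint_wave z : z != 0 -> cint mu D (wave z) = 0.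
Proof.
move=> z0; have m0 : (0 < `|z|)%N by rewrite absz_gt0.
have K0 : (0 < 2 * `|z|)%N by rewrite muln_gt0.
have iw := @sqintegrable_integrable _ _ _ mu D mD muD _ (wave_sq z).
rewrite (tiling_cint (measurable_itv _) mD (interval_tiling K0) iw).
rewrite -[RHS](alternating_sum (cint mu `[0, L / (2 * `|z|)%:R[ (wave z))
  `|z|).
apply: eq_bigr => i _; rewrite -cintZl//; last first.
  have := tiling_cintegrable (measurable_itv _) mD (interval_tiling K0)
    (Ordinal K0) iw.
  rewrite /= (_ : (fun x => _) = wave z)//.
  by apply/funext => x; rewrite mul0r addr0.
apply: eq_cint => x _; rewrite /wave mulrDr addrC expiD; congr (_ * _).
have -> : 2 * pi * z%:~R / L * (i%:R * (L / (2 * `|z|)%:R)) =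
    pi * i%:R * (sgz z)%:~R :> R.
  rewrite {1}(intEsg z) intrM natrM; field.
  by rewrite pnatr_eq0 -lt0n m0 gt_eqF.
have [zlt|zgt|zE] := ltrgtP z 0; last by rewrite zE eqxx in z0.
  by rewrite ltr0_sgz// mulrN mulr1 expiN expi_pi_nat conjc_sign.
by rewrite gtr0_sgz// mulr1 expi_pi_nat.
Qed.

Definition nwave (z : int) (x : R) : C := ((Num.sqrt L)^-1)%:C * wave z x.

Lemma nwave_orthonormal : orthonormal_system mu D nwave.
Proof.
split=> [z|z w]; first by apply: sqintegrableZl => //; exact: wave_sq.
have iw := @sqintegrable_integrable _ _ _ mu D mD muD _ (wave_sq (z - w)).
rewrite /inner (_ : cint _ _ _ = (L^-1)%:C * cint mu D (wave (z - w))); last first.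
  rewrite -cintZl//; apply: eq_cint => x _.
  rewrite /nwave waveD waveN conjcM.
  have -> : (L^-1)%:C = ((Num.sqrt L)^-1)%:C * ((Num.sqrt L)^-1)%:C :> C.
    by rewrite -rmorphM /= -invfM -expr2 sqr_sqrtr// ltW.
  have -> : ((Num.sqrt L)^-1)%:C^* = ((Num.sqrt L)^-1)%:C :> C.
    by apply: complexP; rewrite /= ?oppr0.
  ring.
have [->|zw] := eqVneq z w; last by rewrite cint_wave ?mulr0// subr_eq0.
rewrite subrr (_ : cint _ _ _ = L%:C).
  by rewrite -rmorphM /= mulVf ?gt_eqF.
rewrite (@eq_cint _ _ _ _ _ _ (fun=> 1)); last by move=> x _; exact: wave0.
apply: complexP; rewrite /= Rintegral_cst//; last by rewrite mul0r.
by rewrite [X in fine X]muDE/= mul1r.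
Qed.

Section Totality.
Variable h : R -> C.
Hypotheses (h_sq : sqintegrable mu D h)
  (h_orth : forall z, cint mu D (fun x => h x * wave z x) = 0).

Let orth (k : R -> C) := [/\ cmeasurable D k,
  exists b, forall x, D x -> normc (k x) <= b &
  forall z, cint mu D (fun x => h x * k x * wave z x) = 0].

(** The trigonometric polynomials form an algebra of multipliers of the space of
    bounded functions $k$ for which $hk$ is orthogonal to all exponentials. *)
Let multiplier (q : R -> C) := forall k, orth k -> orth (fun x => q x * k x).

Let orth1 : orth (fun=> 1).
Proof.
split; first exact: cmeasurable_cst.
  by exists 1 => x _; rewrite normc1.
by move=> z; rewrite -[RHS](h_orth z); apply: eq_cint => x _; rewrite mulr1.
Qed.

Let orth_int k z : orth k -> cintegrable mu D (fun x => h x * k x * wave z x).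
Proof.
move=> [mk [b kb] _]; apply: cintegrable_mul => //; last exact: wave_sq.
exact: (sqintegrableM_bounded mD h_sq mk kb).
Qed.

Let multiplier_wave z : multiplier (wave z).
Proof.
move=> k [mk [b kb] ok]; split.
- by apply: cmeasurableM => //; exact: cmeasurable_wave.
- by exists b => x Dx; rewrite normcM normc_expi mul1r kb.
- move=> w; rewrite -[RHS](ok (z + w)); apply: eq_cint => x _.
  rewrite waveD; ring.
Qed.

Let multiplier_scale c q : multiplier q -> multiplier (fun x => c * q x).
Proof.
move=> mq k /mq ok; have [mk [b kb] o] := ok; split.
- apply: (eq_cmeasurable (F := fun x => c * (q x * k x))) => [x|].
    by rewrite mulrA.
  by apply: cmeasurableM => //; exact: cmeasurable_cst.
- by exists (normc c * b) => x Dx; rewrite -mulrA normcM ler_wpM2l ?normc_ge0 ?kb.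
- move=> w; rewrite -[RHS](mulr0 c) -(o w) -cintZl//; last exact: orth_int.
  by apply: eq_cint => x _; ring.
Qed.

Let multiplierD q1 q2 : multiplier q1 -> multiplier q2 ->
  multiplier (fun x => q1 x + q2 x).
Proof.
move=> m1 m2 k ok; have ok1 := m1 _ ok; have ok2 := m2 _ ok.
have [mk1 [b1 kb1] o1] := ok1; have [mk2 [b2 kb2] o2] := ok2; split.
- apply: (eq_cmeasurable (F := fun x => q1 x * k x + q2 x * k x)) => [x|].
    by rewrite mulrDl.
  exact: cmeasurableD.
- exists (b1 + b2) => x Dx.
  by rewrite mulrDl (le_trans (le_normcD _ _))// lerD ?kb1 ?kb2.
- move=> w; rewrite -[RHS](addr0 0) -{1}(o1 w) -(o2 w) -cintD//; try exact: orth_int.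
  by apply: eq_cint => x _; ring.
Qed.

Let multiplier_cst c : multiplier (fun=> c).
Proof.
have := multiplier_scale c (multiplier_wave 0).
by under eq_fun do rewrite wave0 mulr1.
Qed.

Let multiplierM q1 q2 : multiplier q1 -> multiplier q2 ->
  multiplier (fun x => q1 x * q2 x).
Proof. by move=> m1 m2 k /m2/m1; under eq_fun do rewrite mulrA. Qed.

Let multiplierX q n : multiplier q -> multiplier (fun x => q x ^+ n).
Proof.
move=> mq; elim: n => [|n IH]; first exact: multiplier_cst.
by under eq_fun do rewrite exprS; exact: multiplierM.
Qed.

(** Since $2\sin\frac{\pi x}L\sin\frac{\pi(x-a)}L
    =\cos\frac{\pi a}L-\cos\frac{\pi(2x-a)}L$, this is a trigonometric polynomial with
    values in $[0,1]$; the sine factors show that on $(0,L)$ it is below $1/2$ before $a$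
    and above $1/2$ after $a$. *)
Let tilt a x := 1 / 2 + sin (pi / L * x) * sin (pi / L * (x - a)) / 2.

Let multiplier_tilt a : multiplier (fun x => (tilt a x)%:C).
Proof.
rewrite (_ : (fun x => _) = (fun x => (1 / 2 + cos (pi / L * a) / 4)%:C +
   (((- 1 / 8)%:C * expi (- (pi / L * a))) * wave 1 x +
    ((- 1 / 8)%:C * expi (pi / L * a)) * wave (-1) x))); last first.
  apply/funext => x; rewrite waveN expiN.
  have -> : wave 1 x = expi (2 * (pi / L * x)) by congr expi; rewrite mulr1; ring.
  rewrite /tilt mulrBr sinB; set u := pi / L * x; set v := pi / L * a.
  have -> : expi (2 * u) = (cos u * cos u - sin u * sin u) +i* (2 * sin u * cos u).
    by rewrite mulrDl mul1r /expi cosD sinD; congr (_ +i* _); ring.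
  apply: complexP; rewrite ?(cReD,cImD,cReM,cImM) /=; last by ring.
  have z0 : cos v / 4 * (cos u ^+ 2 + sin u ^+ 2 - 1) = 0.
    by rewrite cos2Dsin2 subrr mulr0.
  by rewrite -[RHS]addr0 -[X in _ = _ + X]z0; field.
apply: multiplierD; first exact: multiplier_cst.
by apply: multiplierD; apply: multiplier_scale; exact: multiplier_wave.
Qed.

Let peak_orth a n : cint mu D (fun x => h x * (peak n (tilt a x))%:C) = 0.
Proof.
have mp : multiplier (fun x => (peak n (tilt a x))%:C).
  rewrite (_ : (fun x => _) = fun x => (1 + (-1) * (tilt a x)%:C ^+ n) ^+ (2 ^ n)).
    apply: multiplierX; apply: multiplierD; first exact: multiplier_cst.
    by apply: multiplier_scale; apply: multiplierX; exact: multiplier_tilt.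
  by apply/funext => x; rewrite /peak rmorphXn rmorphB rmorphXn mulN1r.
have [_ _ /(_ 0)] := mp _ orth1; rewrite -[X in _ -> X = _]/(cint _ _ _) => <-.
by apply: eq_cint => x _; rewrite wave0 !mulr1.
Qed.

Let h_int : cintegrable mu D h.
Proof. exact: (@sqintegrable_integrable _ _ _ mu D mD muD). Qed.

Let tilt_itv a x : 0 <= tilt a x <= 1.
Proof.
rewrite /tilt; set s1 := sin _; set s2 := sin _.
have h1 : `|s1| <= 1 by exact: sin_max.
have h2 : `|s2| <= 1 by exact: sin_max.
have : `|s1 * s2| <= 1 by rewrite normrM mulr_ile1.
rewrite ler_norml; lra.
Qed.

Let tilt_lt a x : 0 < a < L -> 0 < x < a -> tilt a x < 1 / 2.
Proof.
move=> /andP[a0 aL] /andP[x0 xa].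
have pL : 0 < pi / L by rewrite divr_gt0// pi_gt0.
have s1 : 0 < sin (pi / L * x).
  apply: sin_gt0_pi; rewrite mulr_gt0//= -ltr_pdivlMl// invf_div.
  by rewrite divfK ?gt_eqF ?pi_gt0//; lra.
have s2 : 0 < sin (pi / L * (a - x)).
  apply: sin_gt0_pi; rewrite mulr_gt0 ?subr_gt0//= -ltr_pdivlMl// invf_div.
  by rewrite divfK ?gt_eqF ?pi_gt0//; lra.
have : sin (pi / L * (x - a)) < 0 by rewrite -(opprB a x) mulrN sinN oppr_lt0.
rewrite /tilt; nra.
Qed.

Let tilt_gt a x : 0 < a < L -> a < x < L -> 1 / 2 < tilt a x.
Proof.
move=> /andP[a0 aL] /andP[ax xL].
have pL : 0 < pi / L by rewrite divr_gt0// pi_gt0.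
have s1 : 0 < sin (pi / L * x).
  apply: sin_gt0_pi; rewrite mulr_gt0//=; last by lra.
  by rewrite -ltr_pdivlMl// invf_div divfK ?gt_eqF ?pi_gt0.
have s2 : 0 < sin (pi / L * (x - a)).
  apply: sin_gt0_pi; rewrite mulr_gt0 ?subr_gt0//= -ltr_pdivlMl// invf_div.
  by rewrite divfK ?gt_eqF ?pi_gt0//; lra.
rewrite /tilt; nra.
Qed.

Let tilt_meas a : measurable_fun D (tilt a).
Proof.
have ms := continuous_measurable_fun (@continuous_sin R).
have m1 : measurable_fun D (fun x => sin (pi / L * x)).
  by apply: (measurable_comp (F := setT) _ _ ms) => //; exact: mulrl_measurable.
have m2 : measurable_fun D (fun x => sin (pi / L * (x - a))).
  apply: (measurable_comp (F := setT) _ _ ms) => //.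
  by apply: measurable_funM => //; exact: measurable_funB.
apply: measurable_funD => //; apply: measurable_funM => //.
exact: measurable_funM.
Qed.

(** Dominated convergence, as the peaks of the tilt converge to the indicator
    function of $[0,a)$ off the two points $0$ and $a$. *)
Let initial_integral0 (f : R -> R) a : 0 < a < L ->
  mu.-integrable D (EFin \o f) ->
  (forall n, \int[mu]_(x in D) (f x * peak n (tilt a x)) = 0) ->
  \int[mu]_(x in `[0, a[) f x = 0.
Proof.
move=> aL fi f0.
pose g n x := (f x * peak n (tilt a x))%:E.
have mf : measurable_fun D f by apply/measurable_EFinP; exact: measurable_int fi.
have mg n : measurable_fun D (g n).
  apply/measurable_EFinP/measurable_funM => //; apply: measurable_funX.
  by apply: measurable_funB => //; exact: measurable_funX.
have aD : `[0, a[ `<=` D.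
  move=> x; rewrite /= !in_itv/= => /andP[-> xa]/=.
  by case/andP: aL => _; apply: lt_trans.
have [] := @dominated_convergence _ _ _ mu D mD g
   (fun x => (f x * (\1_`[0, a[ x))%:E) (fun x => `|(f x)%:E|%E) mg.
- by apply/measurable_EFinP/measurable_funM.
- exists [set 0; a]; split.
  + by apply: measurableU; exact: measurable_set1.
  + apply: countable_lebesgue_measure0; apply: finite_set_countable.
    exact: finite_set2.
  + move=> x /= H; apply: contrapT => /not_orP[x0 xa]; apply: H.
    rewrite in_itv/= => /andP[xge xL].
    have xgt : 0 < x by rewrite lt_neqAle xge andbT eq_sym; apply/eqP.
    apply: cvg_EFin_seq; apply: cvgM; first exact: cvg_cst.
    rewrite indicE; have [xa'|xa'] := ltP x a.
      rewrite mem_set /= ?in_itv/= ?xge//.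
      apply: peak_cvg1; rewrite tilt_lt ?xgt// andbT.
      by have /andP[] := tilt_itv a x.
    rewrite memNset /= ?in_itv/= ?xge ?ltNge ?xa'//.
    apply: peak_cvg0; rewrite tilt_gt//=; first by have /andP[] := tilt_itv a x.
    by rewrite xL andbT lt_neqAle xa' andbT eq_sym; apply/eqP.
- exact: integrable_abse.
- apply: aeW => x n _; rewrite /g EFinM abseM -[leRHS]mule1.
  apply: lee_wpmul2l => //; rewrite lee_fin.
  by have /andP[p0 p1] := peak_itv n (tilt_itv a x); rewrite ger0_norm.
move=> _ _.
rewrite (_ : [sequence _]_n = fun=> 0%E); last first.
  apply/funext => n /=; have := f0 n; rewrite /Rintegral.
  rewrite -[in X in _ -> X](@fineK _ (\int[mu]_(x in D) g n x)%E).
    by rewrite /g => ->.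
  apply: integrable_fin_num => //; apply: le_integrable fi => // x _.
  rewrite /g /= lee_fin normrM -[leRHS]mulr1 ler_wpM2l//.
  by have /andP[p0 p1] := peak_itv n (tilt_itv a x); rewrite ger0_norm.
move=> /(cvg_unique _ (cvg_cst _)) => /(_ (@ereal_hausdorff R)).
move=> E0; rewrite -((setIidPr D `[0, a[).2 aD) Rintegral_mkcondr /Rintegral.
rewrite (eq_integral (fun x : measurableTypeR R =>
  (f x * (\1_`[0, a[ x))%:E)) -?E0// => x _.
by rewrite patchE indicE; case: ifPn => _; rewrite ?mulr1 ?mulr0.
Qed.

(** By Lebesgue's differentiation theorem $f$ is almost everywhere the derivative of
    its integral function. *)
Let vanish (f : R -> R) : mu.-integrable D (EFin \o f) ->
  (forall a, 0 < a < L -> \int[mu]_(x in `[0, a[) f x = 0) ->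
  {ae mu, forall x, D x -> f x = 0}.
Proof.
move=> fi f0; pose g := f \_ D.
have gi : mu.-integrable setT (EFin \o g).
  have := (@integrable_mkcond _ _ _ mu D (EFin \o f) mD).1 fi.
  by rewrite restrict_EFin.
have gS A : measurable A -> mu.-integrable A (EFin \o g).
  by move=> mA; apply: integrableS gi.
have gl : locally_integrable [set: R] g by exact: integrable_locally.
have key := FTC1 (a := BLeft 0) (fun y => gS _ (measurable_itv _)) gl.
have n0 : mu.-negligible [set 0 : R].
  apply/negligibleP; first exact: measurable_set1.
  exact: lebesgue_measure_set1.
have key0 : {ae mu, forall x : R, x != 0}.
  by apply: negligibleS n0 => x /= /negP; rewrite negbK => /eqP.
have aeF := ae_filter_ringOfSetsType mu.
apply: filterS2 key key0 => x + x0.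
move=> + Dx; have /andP[xge xL] : 0 <= x < L by move: Dx; rewrite /= in_itv.
have xgt : 0 < x by rewrite lt_neqAle xge andbT eq_sym.
have x0b : (0%:E < x%:E :> \bar R)%E by rewrite lte_fin.
move=> /(_ x0b)[_]; rewrite {2}/g patchE mem_set// => <-.
rewrite derive1E (near_eq_derive (g := cst 0)) ?derive_cst//.
have /near_in_itvoo : x \in `]0, L[ by rewrite in_itv/= xgt.
apply: filterS => y.
rewrite in_itv/= => /andP[y0 yL].
rewrite -Rintegral_itv_bndo_bndc; last by apply: gS; exact: measurable_itv.
rewrite -[RHS](f0 y)// ?y0//; apply: eq_Rintegral => t.
rewrite inE/= in_itv/= => /andP[t0 ty]; rewrite /g patchE mem_set//=.
by rewrite in_itv/= t0 (lt_trans ty).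
Qed.

(** A function orthogonal to all exponentials is orthogonal to all trigonometric
    polynomials, in particular to the peaks of every tilt, so that its integrals over
    all initial intervals vanish. *)
Lemma orthogonal_waves_ae0 : {ae mu, forall x, D x -> h x = 0}.
Proof.
have [h1 h2] := h_int.
have re0 a n : \int[mu]_(x in D) (Re (h x) * peak n (tilt a x)) = 0.
  rewrite -[RHS](congr1 Re (peak_orth a n)).
  by apply: eq_Rintegral => x _; rewrite cReM /= mulr0 subr0.
have im0 a n : \int[mu]_(x in D) (Im (h x) * peak n (tilt a x)) = 0.
  rewrite -[RHS](congr1 Im (peak_orth a n)).
  by apply: eq_Rintegral => x _; rewrite cImM /= mulr0 add0r.
have v1 := vanish h1 (fun a aL => initial_integral0 aL h1 (re0 a)).
have v2 := vanish h2 (fun a aL => initial_integral0 aL h2 (im0 a)).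
have aeF := ae_filter_ringOfSetsType mu.
apply: filterS2 v1 v2 => x v1 v2 Dx.
by apply: complexP; [exact: v1|exact: v2].
Qed.

End Totality.

Lemma sqnorm_ae0 (T' : set (measurableTypeR R)) (F : R -> C) :
  measurable T' -> cmeasurable T' F ->
  {ae mu, forall x, T' x -> F x = 0} -> sqnorm mu T' F = 0.
Proof.
move=> mT mF F0; rewrite /sqnorm /Rintegral (@ae_eq_integral _ _ _ mu T' (cst 0%E))//.
- by rewrite integral0.
- by apply/measurable_EFinP; exact: measurable_normc2.
- have aeF := ae_filter_ringOfSetsType mu.
  by apply: filterS F0 => x + Tx => /(_ Tx) ->; rewrite normc0 expr0n.
Qed.

Lemma nwave_total : total_system mu D nwave.
Proof.
move=> F iF F0; apply: sqnorm_ae0 => //; first exact: iF.1.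
apply: orthogonal_waves_ae0 => // z.
have := F0 (- z); rewrite /inner.
rewrite (_ : cint _ _ _ = ((Num.sqrt L)^-1)%:C * cint mu D (fun x => F x * wave z x)).
  move/eqP; rewrite mulf_eq0 => /orP[|/eqP//].
  by rewrite eq_complex /= eqxx andbT invr_eq0 sqrtr_eq0 leNgt L0.
rewrite -cintZl//; last by apply: cintegrable_mul => //; exact: wave_sq.
apply: eq_cint => x _; rewrite /nwave waveN !conjcM conjcK.
have -> : ((Num.sqrt L)^-1)%:C^* = ((Num.sqrt L)^-1)%:C :> C.
  by apply: complexP; rewrite /= ?oppr0.
ring.
Qed.

(** The exponentials have norm $\sqrt L$, whence the factor $L$. *)
Lemma parseval_interval (h : R -> C) : sqintegrable mu D h ->
  (\esum_(z in [set: int]) (normc (cint mu D (fun x => h x * (wave z x)^*)) ^+ 2)%:E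
   = (L * sqnorm mu D h)%:E)%E.
Proof.
move=> ih; rewrite mulrC EFinM.
rewrite -(@parseval _ _ _ mu D mD muD _ _ nwave_orthonormal nwave_total _ ih).
have E z : normc (inner mu D h (nwave z)) ^+ 2 =
    normc (cint mu D (fun x => h x * (wave z x)^*)) ^+ 2 / L.
  rewrite /inner (_ : cint _ _ _ =
     ((Num.sqrt L)^-1)%:C * cint mu D (fun x => h x * (wave z x)^*)).
    rewrite normcM exprMn mulrC; congr (_ * _).
    by rewrite normc2E /= expr0n addr0 exprVn sqr_sqrtr// ltW.
  rewrite -cintZl//; last by apply: inner_integrable => //; exact: wave_sq.
  apply: eq_cint => x _; rewrite /nwave conjcM.
  have -> : ((Num.sqrt L)^-1)%:C^* = ((Num.sqrt L)^-1)%:C :> C.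
    by apply: complexP; rewrite /= ?oppr0.
  ring.
under [in RHS]eq_esum do rewrite E mulrC.
rewrite esumZl ?invr_gt0//; last by move=> z; exact: sqr_ge0.
by rewrite muleAC -EFinM mulVf ?gt_eqF// mul1e.
Qed.

End ExponentialsOnInterval.
(** * The exponentials with frequencies in $\Lambda$ on $\Omega$ *)

Section OmegaSystem.
Variables (R : realType) (N r : nat).
Hypotheses (N0 : (0 < N)%N) (r_odd : odd r).
Local Notation mu := (@lebesgue_measure R).
Local Notation TR := (measurableTypeR R).
Local Notation C := R[i].
Local Notation E := (`[0, 2^-1[%classic : set TR).
Local Notation Om := (Omega R N : set TR).
Local Notation Lam := (Lambda R N r).

Definition lwave (l : Lam) (x : TR) : C := expi (2 * pi * val l * x).

Definition half_shift (i : 'I_2) : R := i%:R * (N%:R / 2).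

Let mE : measurable E. Proof. exact: measurable_itv. Qed.

Lemma measurable_Omega : measurable Om.
Proof. by apply: measurableU; exact: measurable_itv. Qed.

Lemma Omega_ltoo : (mu Om < +oo)%E.
Proof.
apply: (@le_lt_trans _ _ (mu (`[0, N%:R + 1[%classic : set TR))).
  apply: le_measure; rewrite ?inE; [exact: measurable_Omega|exact: measurable_itv|].
  have N1 : 1 <= N%:R :> R by rewrite ler1n.
  move=> x [|] /=; rewrite !in_itv/= => /andP[h1 h2]; apply/andP; split; lra.
by rewrite lebesgue_measure_itv/=; case: ifP => _; rewrite ?sube0 ?ltry.
Qed.

Let mOm := measurable_Omega.
Let Omoo := Omega_ltoo.
Let h0 : 0 < 2^-1 :> R. Proof. by rewrite invr_gt0. Qed.

Let muE : mu E = (2^-1)%:E.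
Proof. by rewrite lebesgue_measure_itv/= lte_fin h0 sube0. Qed.

Let Eoo : (mu E < +oo)%E. Proof. by rewrite muE ltry. Qed.

Lemma Omega_halves : tiling half_shift E Om.
Proof.
have N1 : 1 <= N%:R :> R by rewrite ler1n.
have or2 (i : 'I_2) : half_shift i = 0 \/ half_shift i = N%:R / 2.
  by rewrite /half_shift; case: i => -[|[|//]] ?; [left|right]; rewrite ?mul0r ?mul1r.
split=> [i x|y|i j y] /=.
- rewrite /Omega /= !in_itv/= => /andP[x0 x1].
  have [->|->] := or2 i; [left|right]; apply/andP; split; lra.
- rewrite /Omega => -[|] /=; rewrite !in_itv/= => /andP[h1 h2].
    by exists ord0; rewrite in_itv/= /half_shift mul0r subr0 h1/=; lra.
  exists (Ordinal (ltnSn 1)); rewrite in_itv/= /half_shift mul1r.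
  apply/andP; split; lra.
- rewrite !in_itv/= => /andP[i0 i1] /andP[j0 j1]; apply/ord_inj.
  have N2 : 0 < N%:R / 2 :> R by rewrite divr_gt0// ltr0n.
  have c (a b : 'I_2) : (a < b)%N -> half_shift a = 0 /\ half_shift b = N%:R / 2.
    by case: a b => -[|[|//]] ? [[|[|//]] ?]//= _; rewrite /half_shift mul0r mul1r.
  by case: (ltngtP i j) => // /c[e1 e2]; exfalso; move: i0 i1 j0 j1; rewrite e1 e2; lra.
Qed.

Lemma Lambda_cases (l : Lam) : exists (b : bool) (z : int),
  val l = b%:R * (r%:R / N%:R) + 2 * z%:~R.
Proof.
have [z [->|->]] := set_valP l; first by exists false, z; rewrite mul0r add0r.
by exists true, z; rewrite mul1r.
Qed.

Lemma Lambda_mem (b : bool) (z : int) :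
  b%:R * (r%:R / N%:R) + 2 * z%:~R \in Lam.
Proof.
by apply/mem_set; exists z; case: b; [right; rewrite mul1r|left; rewrite mul0r add0r].
Qed.

Definition Lambda_elt b z : Lam := exist (fun x => x \in Lam) _ (Lambda_mem b z).

Lemma Lambda_eltP (l : Lam) : exists b z, l = Lambda_elt b z.
Proof. by have [b [z e]] := Lambda_cases l; exists b, z; apply: val_inj. Qed.

Lemma lwave_elt b z x :
  lwave (Lambda_elt b z) x = expi (2 * pi * b%:R * (r%:R / N%:R) * x) * wave 2^-1 z x.
Proof.
rewrite /lwave /wave -expiD; congr expi; rewrite /= invrK; ring.
Qed.

(** $e^{2\pi i\lambda N/2}=e^{\pi iN\lambda}$ is $1$ for $\lambda\in2\mathbb Z$, and
    $e^{\pi ir}=-1$ on the other coset, as $r$ is odd. *)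
Lemma lwave_shift b z x (i : 'I_2) :
  lwave (Lambda_elt b z) (x + half_shift i) =
  (-1) ^+ (b * i) * lwave (Lambda_elt b z) x.
Proof.
have Nn0 : N%:R != 0 :> R by rewrite pnatr_eq0 -lt0n.
rewrite /lwave mulrDr addrC expiD; congr (_ * _).
have -> : 2 * pi * val (Lambda_elt b z) * half_shift i =
    pi * (b * i * r)%:R + 2 * pi * ((N * i)%:R * z%:~R) :> R.
  by rewrite /half_shift /= !natrM; field.
rewrite -[(N * i)%:R]/((Posz (N * i))%:~R) -intrM expi_periodic expi_pi_nat.
rewrite -[LHS]signr_odd -[RHS]signr_odd; congr (_ ^+ _).
by rewrite !oddM r_odd andbT.
Qed.

Lemma Lambda_elt_inj b z b' z' :
  Lambda_elt b z = Lambda_elt b' z' -> b = b' /\ z = z'.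
Proof.
move=> e; have bb' : b = b'.
  apply: (@signr_inj C).
  have := lwave_shift b z 0 (Ordinal (ltnSn 1)); rewrite e lwave_shift !muln1.
  move=> /(congr1 (fun w => w * (lwave (Lambda_elt b' z') 0)^*)).
  by rewrite -!mulrA expi_mulJ !mulr1 => ->.
split=> //; move: e; rewrite bb' => /(congr1 val) /= /addrI /mulfI.
by rewrite pnatr_eq0 => /(_ isT)/intr_inj.
Qed.

Lemma cmeasurable_lwave l : cmeasurable Om (lwave l).
Proof. exact: cmeasurable_expi. Qed.

Lemma lwave_sq l : sqintegrable mu Om (lwave l).
Proof.
apply: (@sqintegrable_bounded _ _ _ mu Om mOm Omoo _ 1).
  exact: cmeasurable_lwave.
by move=> x _; rewrite normc_expi.
Qed.

(** The two halves of $\Omega$ see the same exponential up to a sign, so the inner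
    product is an integral over one half. *)
Lemma inner_lwave F b z : sqintegrable mu Om F ->
  inner mu Om F (lwave (Lambda_elt b z)) =
  cint mu E (fun x => (\sum_(i < 2) (-1) ^+ (b * i) * F (x + half_shift i)) *
     (lwave (Lambda_elt b z) x)^*).
Proof.
move=> iF; rewrite /inner (tiling_cint mE mOm Omega_halves); last first.
  by apply: inner_integrable => //; exact: lwave_sq.
rewrite -cint_sum//; last first.
  move=> i; apply: (tiling_cintegrable mE mOm Omega_halves i
    (F := fun x => F x * (lwave (Lambda_elt b z) x)^*)).
  by apply: inner_integrable => //; exact: lwave_sq.
apply: eq_cint => x _; rewrite mulr_suml; apply: eq_bigr => i _.
by rewrite lwave_shift conjcM conjc_sign; ring.
Qed.

(** For frequencies in different cosets of $2\mathbb Z$ the contributions of the two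
    halves of $\Omega$ cancel. *)
Lemma lwave_orthonormal : orthonormal_system mu Om lwave.
Proof.
split=> [l|l m]; first exact: lwave_sq.
have [b [z ->]] := Lambda_eltP l; have [b' [z' ->]] := Lambda_eltP m.
rewrite inner_lwave; last exact: lwave_sq.
under eq_cint => x _.
  under eq_bigr do rewrite lwave_shift mulrA -exprD -mulnDl.
  rewrite -mulr_suml !big_ord_recl big_ord0 addr0 muln0 muln1 expr0 -mulrA.
  over.
have [bb'|bb'] := eqVneq b b'; last first.
  have -> : (1 + (-1) ^+ (b' + b) : C) = 0.
    by case: (b) (b') bb' => -[]//= _; rewrite expr1 subrr.
  rewrite (_ : (_ == _) = false); last first.
    by apply/negbTE/eqP => /Lambda_elt_inj[e _]; rewrite e eqxx in bb'.
  by rewrite -[RHS](cint0 mu mE); apply: eq_cint => x _; rewrite mul0r.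
rewrite -{b'}bb'.
have iw w : cintegrable mu E (wave 2^-1 w).
  by apply: (@sqintegrable_integrable _ _ _ mu E mE Eoo); exact: wave_sq.
rewrite (_ : cint _ _ _ = 2 * cint mu E (wave 2^-1 (z - z'))); last first.
  rewrite -cintZl//; apply: eq_cint => x _.
  have -> : (1 + (-1) ^+ (b + b) : C) = 2.
    by case: (b) => /=; rewrite ?sqrrN ?expr1n ?expr0.
  congr (_ * _); rewrite !lwave_elt conjcM waveD waveN mulrACA expi_mulJ.
  by rewrite mul1r.
have [->|zz'] := eqVneq z z'.
  rewrite eqxx subrr (@eq_cint _ _ _ _ _ _ (fun=> 1)); last by move=> x _; exact: wave0.
  have -> : cint mu E (fun=> 1) = (2^-1)%:C.
    apply: complexP; rewrite /= Rintegral_cst//; last by rewrite mul0r.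
    by rewrite [X in fine X]muE/= mul1r.
  by apply: complexP; rewrite ?cReM ?cImM /=; field.
rewrite cint_wave ?mulr0 ?subr_eq0//; case: eqP => // /Lambda_elt_inj[_ e].
by rewrite e eqxx in zz'.
Qed.

(** If $F$ is orthogonal to the system, then $F(x)+F(x+N/2)$ and a unimodular multiple
    of $F(x)-F(x+N/2)$ are orthogonal to all exponentials of period $1/2$ on
    $[0,1/2)$, hence vanish. *)
Lemma lwave_total : total_system mu Om lwave.
Proof.
move=> F iF F0.
pose G b x : C := (\sum_(i < 2) (-1) ^+ (nat_of_bool b * i) * F (x + half_shift i)) *
  (expi (2 * pi * b%:R * (r%:R / N%:R) * x))^*.
have iFi i : sqintegrable mu E (fun x => F (x + half_shift i)).
  exact: (tiling_sqintegrable mE mOm Omega_halves).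
have iG b : sqintegrable mu E (G b).
  apply: (@sqintegrableM_bounded _ _ _ mu E mE _ _ 1).
  - by apply: sqintegrable_sum => // i; exact: sqintegrableZl.
  - by apply: cmeasurableJ; exact: cmeasurable_expi.
  - by move=> x _; rewrite normcJ_sq normc_expi.
have G0 b : {ae mu, forall x, E x -> G b x = 0}.
  apply: orthogonal_waves_ae0 => // z.
  rewrite -[RHS](F0 (Lambda_elt b (- z))) inner_lwave//.
  apply: eq_cint => x _; rewrite lwave_elt conjcM waveN conjcK mulrA.
  by [].
have Fi0 i : sqnorm mu E (fun x => F (x + half_shift i)) = 0.
  apply: sqnorm_ae0 => //; first exact: (iFi i).1.
  have aeF := ae_filter_ringOfSetsType mu.
  apply: filterS2 (G0 false) (G0 true) => x h1 h2 Ex.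
  have sum0 b : \sum_(i < 2) (-1) ^+ (nat_of_bool b * i) * F (x + half_shift i) = 0.
    have /(_ Ex) : E x -> G b x = 0 by case: (b).
    move=> /(congr1 (fun w => w * expi (2 * pi * b%:R * (r%:R / N%:R) * x))).
    by rewrite /G -[_ * _ * expi _]mulrA [(expi _)^* * _]mulrC expi_mulJ mulr1 mul0r.
  have := sum0 false; have := sum0 true.
  rewrite !big_ord_recl !big_ord0 /= !mul0n !mul1n !expr0 expr1 !mul1r !addr0 mulN1r.
  set a0 := F _; set a1 := F _ => /eqP; rewrite subr_eq0 => /eqP e01.
  move=> /eqP; rewrite -e01 -mulr2n mulrn_eq0 /= => /eqP a00.
  have [->|->] : i = ord0 \/ i = lift ord0 ord0; last 2 first.
  - exact: a00.
  - by rewrite -/a1 -e01.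
  by case: (unliftP ord0 i) => [j ->|->]; [right; rewrite (ord1 j)|left].
by rewrite (tiling_sqnorm mE mOm Omega_halves iF) big1.
Qed.

End OmegaSystem.
(** * Fourier representatives on $\Omega$ and the inner product of $\ell^2$ *)

Section FourierRepresentatives.
Variables (R : realType) (N r : nat).
Hypotheses (N0 : (0 < N)%N) (r_odd : odd r).
Local Notation mu := (@lebesgue_measure R).
Local Notation TR := (measurableTypeR R).
Local Notation C := R[i].
Local Notation Re := (@complex.Re R).
Local Notation Im := (@complex.Im R).
Local Notation Om := (Omega R N : set TR).
Local Notation Lam := (Lambda R N r).
Local Notation lw := (@lwave R N r).
Implicit Type u : Lam -> C.

Let mOm : measurable Om. Proof. exact: measurable_Omega. Qed.
Let Omoo : (mu Om < +oo)%E. Proof. exact: Omega_ltoo. Qed.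
Let onb : orthonormal_system mu Om lw. Proof. exact: lwave_orthonormal. Qed.
Let tot : total_system mu Om lw. Proof. exact: lwave_total. Qed.

Lemma L2_OmegaP F : L2_Omega N F <-> sqintegrable mu Om F.
Proof.
split=> [[m1 m2 fin]|[[m1 m2] iF]].
  split; first by split.
  apply/integrableP; split; first by apply/measurable_EFinP; exact: measurable_normc2.
  by under eq_integral do rewrite /= ger0_norm ?sqr_ge0//.
split=> //; have /integrableP[_] := iF.
by under eq_integral do rewrite /= ger0_norm ?sqr_ge0//.
Qed.

Lemma is_fourierP u F : is_fourier u F <-> represents mu Om lw u F.
Proof.
have E e (B : {fset Lam}) : sqintegrable mu Om F ->
    (\int[mu]_(x in Om)
       (normc (F x - \sum_(l <- B) u l * expi (2 * pi * val l * x)) ^+ 2)%:E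
     <= e%:E)%E = (sqnorm mu Om (fun x => F x - partial lw u B x) <= e).
  move=> iF; rewrite -lee_fin -sqnormE//.
  by apply: sqintegrableB => //; exact: (partial_sq mOm onb).
split=> [[/L2_OmegaP iF h]|[iF h]]; split => //.
- by move=> e /h[A hA]; exists A => B /hA; rewrite E.
- exact/L2_OmegaP.
- by move=> e /h[A hA]; exists A => B /hA; rewrite E.
Qed.

Lemma fourier_scalar_represents u :
  (\esum_(l in [set: Lam]) (normc (u l) ^+ 2)%:E < +oo)%E ->
  represents mu Om lw u (fourier_scalar u).
Proof.
move=> /(@riesz_fischer _ _ _ mu Om mOm Omoo _ _ onb)[F /is_fourierP repF].
by apply/is_fourierP; exact: (xgetPex (fun=> 0) (ex_intro _ F repF)).
Qed.

(** * Polarization and displacement *)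

(** The positive part of $a-b$ plus $b$ is its negative part plus $a$. *)
Lemma rsum_sub (a b : Lam -> R) :
  (forall l, 0 <= a l) -> (forall l, 0 <= b l) ->
  (\esum_(l in [set: Lam]) (a l)%:E < +oo)%E ->
  (\esum_(l in [set: Lam]) (b l)%:E < +oo)%E ->
  rsum (fun l => a l - b l) = fine (\esum_(l in [set: Lam]) (a l)%:E)
                            - fine (\esum_(l in [set: Lam]) (b l)%:E).
Proof.
move=> a0 b0 afin bfin; rewrite /rsum.
pose P := \esum_(l in [set: Lam]) (Num.max (a l - b l) 0)%:E.
pose Q := \esum_(l in [set: Lam]) (Num.max (- (a l - b l)) 0)%:E.
have fin_of (c d : Lam -> R) : (forall l, 0 <= c l) -> (forall l, c l <= d l) ->
    (\esum_(l in [set: Lam]) (d l)%:E < +oo)%E ->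
    (\esum_(l in [set: Lam]) (c l)%:E)%E \is a fin_num.
  move=> c0 cd dfin; rewrite ge0_fin_numE; last first.
    by apply: esum_ge0 => l _; rewrite lee_fin.
  by apply: le_lt_trans dfin; apply: le_esum => l _; rewrite lee_fin.
have m0 (x : R) : 0 <= Num.max x 0 by rewrite le_max lexx orbT.
have Pf : P \is a fin_num.
  by apply: (fin_of _ a) => // l; rewrite ge_max a0 lerBlDr lerDl b0.
have Qf : Q \is a fin_num.
  by apply: (fin_of _ b) => // l; rewrite ge_max b0 opprB lerBlDr lerDl a0.
have Af : \esum_(l in [set: Lam]) (a l)%:E \is a fin_num by exact: (fin_of _ a).
have Bf : \esum_(l in [set: Lam]) (b l)%:E \is a fin_num by exact: (fin_of _ b).
have : (P + \esum_(l in [set: Lam]) (b l)%:E =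
        \esum_(l in [set: Lam]) (a l)%:E + Q)%E.
  rewrite -!esumD; try (by move=> l _; rewrite lee_fin).
  apply: eq_esum => l _; rewrite -!EFinD; congr EFin.
  rewrite /Num.max; case: ifP; case: ifP; lra.
move=> /(congr1 fine); rewrite !fineD// -/P -/Q; lra.
Qed.

Lemma represents_lincomb u v F G c : represents mu Om lw u F ->
  represents mu Om lw v G ->
  represents mu Om lw (fun l => u l + c * v l) (fun x => F x + c * G x).
Proof.
move=> /(representsP mOm Omoo onb tot)[iF Fu] /(representsP mOm Omoo onb tot)[iG Gv].
apply/(representsP mOm Omoo onb tot); split.
  by apply: sqintegrableD => //; exact: sqintegrableZl.
move=> l; have il := lwave_sq N0 l.
rewrite innerDl// ?innerZl// ?Fu ?Gv//.
exact: sqintegrableZl.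
Qed.

Section Matrices.
Variable n : nat.
Local Notation seqM := (Lam -> 'M[C]_n).
Local Notation funM := ('I_n -> 'I_n -> TR -> C).
Implicit Types (g h : seqM) (G H : funM).

Lemma enorm_sq p q (A : 'M[C]_(p, q)) :
  enorm A ^+ 2 = \sum_i \sum_j normc (A i j) ^+ 2.
Proof.
rewrite sqr_sqrtr//; apply: sumr_ge0 => i _; apply: sumr_ge0 => j _.
exact: sqr_ge0.
Qed.

Definition matrix_represents g G :=
  forall m k, represents mu Om lw (fun l => g l m k) (G m k).

Definition matrix_sqnorm G := \sum_m \sum_k sqnorm mu Om (G m k).

Lemma fourier_represents g : l2 g ->
  matrix_represents g (fun m k x => fourier g x m k).
Proof.
move=> gfin m k; have := @fourier_scalar_represents (fun l => g l m k).
rewrite (_ : (fun x => fourier g x m k) = fourier_scalar (fun l => g l m k)).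
  apply; apply: le_lt_trans gfin; apply: le_esum => l _.
  rewrite lee_fin enorm_sq (bigD1 m)//= (bigD1 k)//= -addrA lerDl.
  rewrite addr_ge0//; apply: sumr_ge0 => i _; first exact: sqr_ge0.
  by apply: sumr_ge0 => j _; exact: sqr_ge0.
by apply/funext => x; rewrite mxE.
Qed.

Lemma matrix_parseval g G : matrix_represents g G ->
  (\esum_(l in [set: Lam]) (\sum_m \sum_k normc (g l m k) ^+ 2)%:E
   = (matrix_sqnorm G)%:E)%E.
Proof.
move=> repG.
under eq_esum do rewrite -sumEFin.
rewrite esum_sum; last first.
  by move=> i j _ _; rewrite lee_fin; apply: sumr_ge0 => q _; exact: sqr_ge0.
rewrite /matrix_sqnorm -sumEFin; apply: eq_bigr => m _.
under eq_esum do rewrite -sumEFin.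
rewrite esum_sum; last by move=> i j _ _; rewrite lee_fin sqr_ge0.
rewrite -sumEFin; apply: eq_bigr => k _.
exact: (represents_norm mOm onb (repG m k)).
Qed.

Lemma l2_esum g : (\esum_(l in [set: Lam]) (enorm (g l) ^+ 2)%:E =
  \esum_(l in [set: Lam]) (\sum_m \sum_k normc (g l m k) ^+ 2)%:E)%E.
Proof. by apply: eq_esum => l _; rewrite enorm_sq. Qed.

Lemma matrix_represents_l2 g G : matrix_represents g G -> l2 g.
Proof. by move=> /matrix_parseval e; rewrite /l2 l2_esum e ltry. Qed.

Lemma l2norm_sq g G : matrix_represents g G -> l2norm g ^+ 2 = matrix_sqnorm G.
Proof.
move=> /matrix_parseval e; rewrite /l2norm l2_esum e sqr_sqrtr//=.
by apply: sumr_ge0 => m _; apply: sumr_ge0 => k _; exact: sqnorm_ge0.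
Qed.

(** $4\,\mathrm{Re}\langle g,h\rangle=\|g+h\|^2-\|g-h\|^2$ on both sides. *)
Lemma rsum_polarization g h G H :
  matrix_represents g G -> matrix_represents h H ->
  rsum (fun l => Re (\sum_m \sum_q g l m q * (h l m q)^*)) =
  Re (\sum_m \sum_q inner mu Om (G m q) (H m q)).
Proof.
move=> repG repK.
have rep c : matrix_represents (fun l => \matrix_(m, q) (g l m q + c * h l m q))
    (fun m q x => G m q x + c * H m q x).
  move=> m q; have := represents_lincomb c (repG m q) (repK m q).
  by congr represents; apply/funext => l; rewrite mxE.
pose nrm c l := \sum_m \sum_q normc (g l m q + c * h l m q) ^+ 2.
have nrm0 c l : 0 <= nrm c l.
  by apply: sumr_ge0 => m _; apply: sumr_ge0 => q _; exact: sqr_ge0.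
have pars c : (\esum_(l in [set: Lam]) (4^-1 * nrm c l)%:E =
    (4^-1 * matrix_sqnorm (fun m q x => G m q x + c * H m q x))%:E)%E.
  rewrite esumZl// ?invr_gt0// EFinM; congr (_ * _)%E.
  rewrite -(matrix_parseval (rep c)).
  apply: eq_esum => l _; congr EFin.
  by apply: eq_bigr => m _; apply: eq_bigr => q _; rewrite mxE.
transitivity (rsum (fun l => 4^-1 * nrm 1 l - 4^-1 * nrm (-1) l)).
  congr rsum; apply/funext => l; rewrite -mulrBr /nrm -sumrB cRe_sum mulr_sumr.
  apply: eq_bigr => m _; rewrite -sumrB cRe_sum mulr_sumr; apply: eq_bigr => q _.
  rewrite !normc2E mul1r mulN1r !cReD !cImD !cReN !cImN cReM cReJ cImJ.
  by field.
rewrite (@rsum_sub (fun l => 4^-1 * nrm 1 l) (fun l => 4^-1 * nrm (-1) l)).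
- rewrite !pars /= /matrix_sqnorm -mulrBr -sumrB cRe_sum mulr_sumr.
  apply: eq_bigr => m _; rewrite -sumrB cRe_sum mulr_sumr; apply: eq_bigr => q _.
  have iG := (repG m q).1; have iK := (repK m q).1.
  have e1 : sqnorm mu Om (fun x => G m q x + 1 * H m q x) = sqnorm mu Om (G m q)
     + 2 * Re (inner mu Om (G m q) (H m q)) + sqnorm mu Om (H m q).
    have iKN : sqintegrable mu Om (fun x => (-1) * H m q x) by exact: sqintegrableZl.
    rewrite (@eq_sqnorm _ _ _ mu Om _ (fun x => G m q x - (-1) * H m q x)); last first.
      by move=> x _; rewrite mulN1r opprK mul1r.
    rewrite sqnormB// (innerJ mOm iKN iG) innerZl// cReJ mulN1r cReN.
    rewrite (innerJ mOm iG iK) cReJ.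
    rewrite (_ : sqnorm mu Om (fun x => -1 * H m q x) = sqnorm mu Om (H m q)).
      by ring.
    by apply: eq_Rintegral => x _; rewrite mulN1r normc_opp.
  have e2 : sqnorm mu Om (fun x => G m q x + (-1) * H m q x) = sqnorm mu Om (G m q)
     - 2 * Re (inner mu Om (G m q) (H m q)) + sqnorm mu Om (H m q).
    rewrite -sqnormB//; apply: eq_sqnorm => x _; rewrite mulN1r//.
  by rewrite e1 e2; field.
- by move=> l; rewrite mulr_ge0 ?invr_ge0.
- by move=> l; rewrite mulr_ge0 ?invr_ge0.
- by rewrite pars ltry.
- by rewrite pars ltry.
Qed.

(** The imaginary part is the real part of the inner product with $i$ times the second
    argument. *)
Lemma l2dotE g h G H : matrix_represents g G -> matrix_represents h H ->
  l2dot g h = \sum_m \sum_q inner mu Om (G m q) (H m q).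
Proof.
move=> repG repK; apply: complexP => /=; first exact: (rsum_polarization repG repK).
have repiK : matrix_represents (fun l => \matrix_(m, q) (0 + 'i * h l m q))
    (fun m q x => 0 + 'i * H m q x).
  move=> m q.
  have rep0 : represents mu Om lw (fun=> 0) (fun=> 0).
    apply/(representsP mOm Omoo onb tot); split; first exact: sqintegrable0.
    move=> l; rewrite /inner -[RHS](cint0 mu mOm); apply: eq_cint => x _.
    by rewrite mul0r.
  have := represents_lincomb 'i rep0 (repK m q).
  by congr represents; apply/funext => l; rewrite mxE.
transitivity (rsum (fun l => Re (\sum_m \sum_q g l m q *
    ((\matrix_(m, q) (0 + 'i * h l m q)) m q)^*))).
  congr rsum; apply/funext => l; rewrite cRe_sum cIm_sum; apply: eq_bigr => m _.
  rewrite cRe_sum cIm_sum; apply: eq_bigr => q _.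
  by rewrite mxE add0r conjCE conjcM !(cReM, cImM, cReJ, cImJ) /=; ring.
rewrite (rsum_polarization repG repiK) cRe_sum cIm_sum; apply: eq_bigr => m _.
rewrite cRe_sum cIm_sum; apply: eq_bigr => q _.
have iG := (repG m q).1; have iK := (repK m q).1.
have iiK : sqintegrable mu Om (fun x => 0 + 'i * H m q x) := (repiK m q).1.
rewrite (innerJ mOm iiK iG) cReJ (innerJ mOm iK iG) cImJ.
rewrite (_ : inner mu Om _ _ = 'i * inner mu Om (H m q) (G m q)).
  by rewrite cReM /=; ring.
by rewrite -innerZl//; apply: eq_cint => x _; rewrite add0r.
Qed.

Definition modulation (l : Lam) (x : R) : C := expi (2 * pi * (2 * N%:R * val l) * x).

(** $e^{2\pi i\cdot2N\lambda x}\overline{e^{2\pi i\lambda' x}}$ is the conjugate of the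
    exponential with frequency $\lambda'-2N\lambda$. *)
Lemma displacement_represents l g G : matrix_represents g G ->
  matrix_represents (displacement l g) (fun m q x => G m q x * modulation l x).
Proof.
move=> repG m q; have /(representsP mOm Omoo onb tot)[iG Gg] := repG m q.
apply/(representsP mOm Omoo onb tot); split.
  apply: (@sqintegrableM_bounded _ _ _ mu Om mOm _ _ 1) => //.
    exact: cmeasurable_expi.
  by move=> x _; rewrite normc_expi.
move=> l'; rewrite /displacement -Gg; apply: eq_cint => x _.
rewrite -mulrA; congr (_ * _).
rewrite /modulation /lwave -!expiN -expiD; congr expi => /=; ring.
Qed.

Lemma l2dot_displacement l g h G H :
  matrix_represents g G -> matrix_represents h H ->
  l2dot g (displacement l h) =
  \sum_m \sum_q cint mu Om (fun x => G m q x * (H m q x)^* * (modulation l x)^*).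
Proof.
move=> repG repK; rewrite (l2dotE repG (displacement_represents l repK)).
apply: eq_bigr => m _; apply: eq_bigr => q _; apply: eq_cint => x _.
by rewrite conjcM mulrA.
Qed.

End Matrices.

End FourierRepresentatives.
(** * Fiberization of the frame sum *)

Section Fibers.
Variables (R : realType) (N r : nat).
Hypothesis N0 : (0 < N)%N.
Local Notation mu := (@lebesgue_measure R).
Local Notation TR := (measurableTypeR R).
Local Notation C := R[i].
Local Notation Om := (Omega R N : set TR).
Local Notation Lam := (Lambda R N r).
Local Notation step := ((4 * N)%:R^-1 : R).
Local Notation cell := (`[0, step[%classic : set TR).

Definition grid (i : 'I_(4 * N)) : R :=
  if (i < 2 * N)%N then i%:R / (4 * N)%:R
  else N%:R / 2 + (i - 2 * N)%N%:R / (4 * N)%:R.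

Let mOm : measurable Om. Proof. exact: measurable_Omega. Qed.
Let mcell : measurable cell. Proof. exact: measurable_itv. Qed.

Lemma step_gt0 : 0 < step.
Proof. by rewrite invr_gt0 ltr0n muln_gt0. Qed.

Let half_steps : (2 * N)%:R * step = 2^-1.
Proof.
have Nn0 : N%:R != 0 :> R by rewrite pnatr_eq0 -lt0n.
by rewrite !natrM; field.
Qed.

Lemma grid_tiling : tiling grid cell Om.
Proof.
have h0 := step_gt0; have N1 : 1 <= N%:R :> R by rewrite ler1n.
have low (k : nat) x : (k < 2 * N)%N -> 0 <= x < step ->
    0 <= x + k%:R * step < 2^-1.
  move=> k2 /andP[x0 x1]; have : 0 <= k%:R * step by rewrite mulr_ge0// ltW.
  have : k.+1%:R * step <= 2^-1 by rewrite -half_steps ler_pM2r// ler_nat.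
  rewrite -natr1; lra.
have sub2 (i : 'I_(4 * N)) : (i < 2 * N)%N = false -> (i - 2 * N < 2 * N)%N.
  by move=> i2; have := ltn_ord i; lia.
split=> [i x|y|i j y] /=.
- rewrite /Omega /= !in_itv/= /grid => xcell.
  case: ifP => [/low/(_ xcell)|/sub2/low/(_ xcell)] /andP[l1 l2].
    by left; apply/andP; split; lra.
  by right; apply/andP; split; lra.
- rewrite /Omega /= => -[|] /=; rewrite !in_itv/= => yh.
    have /(subdivision_index h0)[i hi] : 0 <= y < (2 * N)%:R * step.
      by rewrite half_steps; lra.
    have i4 : (i < 4 * N)%N by have := ltn_ord i; lia.
    by exists (Ordinal i4); rewrite in_itv /grid /= ltn_ord.
  have /(subdivision_index h0)[i hi] : 0 <= y - N%:R / 2 < (2 * N)%:R * step.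
    by rewrite half_steps; lra.
  have i4 : (2 * N + i < 4 * N)%N by have := ltn_ord i; lia.
  exists (Ordinal i4); rewrite in_itv /grid /=.
  by rewrite ltnNge leq_addr /= addKn opprD addrA.
- rewrite !in_itv/= /grid; wlog ij : i j / (i <= j)%N => [wlg|].
    move=> hi hj; case: (leqP i j) => [ij|/ltnW ij]; first exact: wlg hi hj.
    by apply/esym; exact: wlg hj hi.
  case: ifP => i2; case: ifP => j2; rewrite ?opprD ?addrA => hi hj.
  + by apply/ord_inj; exact: (subdivision_unique h0 hi hj).
  + exfalso; have : i.+1%:R * step <= 2^-1 by rewrite -half_steps ler_pM2r// ler_nat.
    have : 0 <= (j - 2 * N)%N%:R * step by rewrite mulr_ge0// ltW.
    rewrite -natr1; move: hi hj; lra.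
  + by move: (leq_ltn_trans ij j2); rewrite i2.
  + have e := subdivision_unique h0 hi hj; apply/ord_inj.
    by move: i2 j2 e; lia.
Qed.

(** The factor by which $e^{2\pi i\cdot 2N\lambda x}$ differs from an exponential of
    period $1/(4N)$. *)
Definition twist (b : bool) (x : R) : C := expi (4 * pi * r%:R * b%:R * x).

Lemma modulation_elt b z x :
  modulation (Lambda_elt R N r b z) x = twist b x * wave step z x.
Proof.
have Nn0 : N%:R != 0 :> R by rewrite pnatr_eq0 -lt0n.
rewrite /modulation /twist /wave -expiD; congr expi => /=.
by rewrite invrK natrM; field.
Qed.

Lemma grid_multiple i : exists k : nat, (4 * N)%:R * grid i = k%:R.
Proof.
have N4 : (4 * N)%:R != 0 :> R by rewrite pnatr_eq0 muln_eq0 -lt0n N0.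
rewrite /grid; case: ifP => _; first by exists i; rewrite mulrC divfK.
exists (2 * N * N + (i - 2 * N))%N.
rewrite mulrDr [_ * (_ / (4 * N)%:R)]mulrC divfK// natrD; congr (_ + _).
by rewrite !natrM; field.
Qed.

Lemma wave_grid z x i : wave step z (x + grid i) = wave step z x.
Proof.
have [k hk] := grid_multiple i.
rewrite /wave invrK mulrDr -[2 * pi * z%:~R * _ * grid i]mulrA hk.
rewrite (_ : 2 * pi * z%:~R * k%:R = 2 * pi * (z * k%:Z)%:~R) ?expi_periodic//.
by rewrite intrM mulrA.
Qed.

Lemma twist_grid b x i : twist b (x + grid i) =
  if b then Evec N r x i 0 else 1.
Proof.
rewrite /twist; case: b => /=; last by rewrite mulr0 mul0r expi0.
rewrite mulr1 mxE /grid; case: ifP => i2; first by rewrite modn_small.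
have -> : (i %% (2 * N))%N = (i - 2 * N)%N.
  have i2' : (2 * N <= i)%N by rewrite leqNgt i2.
  rewrite -{1}(subnK i2') modnDr modn_small//.
  by have := ltn_ord i; lia.
rewrite -[RHS](expi_periodic _ (r * N)%N); congr expi.
have -> : (Posz (r * N))%:~R = r%:R * N%:R :> R by rewrite -natrM.
by rewrite natrM; field; rewrite pnatr_eq0 -lt0n.
Qed.

Definition fold (b : bool) (H : TR -> C) (x : TR) : C :=
  \sum_i H (x + grid i) * (twist b (x + grid i))^*.

Lemma twisted_sq b H : sqintegrable mu Om H ->
  sqintegrable mu Om (fun x => H x * (twist b x)^*).
Proof.
move=> iH; apply: (@sqintegrableM_bounded _ _ _ mu Om mOm _ _ 1) => //.
  by apply: cmeasurableJ; exact: cmeasurable_expi.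
by move=> x _; rewrite normcJ_sq normc_expi.
Qed.

Lemma fold_sq b H : sqintegrable mu Om H -> sqintegrable mu cell (fold b H).
Proof.
move=> iH; apply: sqintegrable_sum => // i.
exact: (tiling_sqintegrable mcell mOm grid_tiling i (twisted_sq b iH)).
Qed.

Lemma cint_modulation b z H : sqintegrable mu Om H ->
  cint mu Om (fun x => H x * (modulation (Lambda_elt R N r b z) x)^*) =
  cint mu cell (fun x => fold b H x * (wave step z x)^*).
Proof.
move=> iH; have iHm : cintegrable mu Om
    (fun x => H x * (modulation (Lambda_elt R N r b z) x)^*).
  apply: (@sqintegrable_integrable _ _ _ mu Om mOm); first exact: Omega_ltoo.
  apply: (@sqintegrableM_bounded _ _ _ mu Om mOm _ _ 1) => //.
    by apply: cmeasurableJ; exact: cmeasurable_expi.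
  by move=> x _; rewrite normcJ_sq normc_expi.
rewrite (tiling_cint mcell mOm grid_tiling iHm) -cint_sum//; last first.
  by move=> i; exact: (tiling_cintegrable mcell mOm grid_tiling i iHm).
apply: eq_cint => x _; rewrite /fold mulr_suml; apply: eq_bigr => i _.
by rewrite modulation_elt conjcM wave_grid mulrA.
Qed.

Hypothesis r_odd : odd r.

Lemma esum_Lambda (a : Lam -> R) : (forall l, 0 <= a l) ->
  (\esum_(l in [set: Lam]) (a l)%:E =
   \esum_(z in [set: int]) (a (Lambda_elt R N r false z))%:E +
   \esum_(z in [set: int]) (a (Lambda_elt R N r true z))%:E)%E.
Proof.
move=> a0; rewrite (esumID [set Lambda_elt R N r false z | z in [set: int]]); last first.
  by move=> l _; rewrite lee_fin.
have inj b : set_inj [set: int] (Lambda_elt R N r b).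
  by move=> z z' _ _ /(Lambda_elt_inj N0 r_odd)[].
rewrite setTI esum_image//; congr (_ + _)%E.
rewrite setTI (_ : ~` _ = [set Lambda_elt R N r true z | z in [set: int]]) ?esum_image//.
apply/seteqP; split=> [l|_ [z _ <-] [z' _ /(Lambda_elt_inj N0 r_odd)[]//]].
have [b [z ->]] := Lambda_eltP l; case: b => [_|h]; first by exists z.
by exfalso; apply: h; exists z.
Qed.

(** As $\lambda$ runs through one of the two cosets of $2\mathbb Z$ in $\Lambda$, the
    modulations are a fixed twist times all exponentials of period $1/(4N)$, so that
    Parseval's identity on the cell applies to each coset. *)
Lemma fold_parseval H : sqintegrable mu Om H ->
  (\esum_(l in [set: Lam])
     (normc (cint mu Om (fun x => H x * (modulation l x)^*)) ^+ 2)%:E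
   = (step * (sqnorm mu cell (fold false H) + sqnorm mu cell (fold true H)))%:E)%E.
Proof.
move=> iH; rewrite esum_Lambda; last by move=> l; exact: sqr_ge0.
rewrite mulrDr EFinD -!(parseval_interval step_gt0); try exact: fold_sq.
by congr (_ + _)%E; apply: eq_esum => z _; rewrite cint_modulation.
Qed.

(** * The frame sum *)

Section FrameSum.
Variables (n p : nat) (f : 'I_p -> Lam -> 'M[C]_n) (b0 : R).
Hypothesis f_l2 : forall j, l2 (f j).
Hypothesis f_bound : forall j, {ae mu, forall x,
  Omega R N x -> enorm (fourier (f j) x) <= b0}.
Local Notation funM := ('I_n -> 'I_n -> TR -> C).
Implicit Types (G : funM) (g : Lam -> 'M[C]_n).

(** The function whose Fourier coefficients at the frequencies $2N\lambda$ are the frame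
    coefficients against the displacements of [f j]. *)
Definition symbol j G (x : TR) : C :=
  \sum_m \sum_k G m k x * (fourier (f j) x m k)^*.

Definition fiber G (x : TR) (m k : 'I_n) : 'cV[C]_(4 * N) :=
  \col_i G m k (x + grid i).

Lemma normc_entry_le q t (A : 'M[C]_(q, t)) i j : normc (A i j) <= enorm A.
Proof.
rewrite -(@ler_pXn2r _ 2)// ?nnegrE ?normc_ge0 ?sqrtr_ge0// enorm_sq.
rewrite (bigD1 i)//= (bigD1 j)//= -addrA lerDl.
rewrite addr_ge0//; apply: sumr_ge0 => k _; first exact: sqr_ge0.
by apply: sumr_ge0 => l _; exact: sqr_ge0.
Qed.

Let fr j := fourier_represents N0 r_odd (f_l2 j).

Lemma symbol_term_sq j G m k : sqintegrable mu Om (G m k) ->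
  sqintegrable mu Om (fun x => G m k x * (fourier (f j) x m k)^*).
Proof.
move=> iG; apply: (@sqintegrableM_ae_bounded _ _ _ mu Om mOm _ _ b0) => //.
  by apply: cmeasurableJ; exact: (fr j m k).1.1.
have aeF := ae_filter_ringOfSetsType mu.
apply: filterS (f_bound j) => x + Ox => /(_ Ox); rewrite normcJ_sq.
exact/le_trans/normc_entry_le.
Qed.

Lemma symbol_sq j G : (forall m k, sqintegrable mu Om (G m k)) ->
  sqintegrable mu Om (symbol j G).
Proof.
move=> iG; apply: sqintegrable_sum => // m; apply: sqintegrable_sum => // k.
exact: symbol_term_sq.
Qed.

Lemma l2dot_symbol j g G l : matrix_represents g G ->
  l2dot g (displacement l (f j)) =
  cint mu Om (fun x => symbol j G x * (modulation l x)^*).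
Proof.
move=> repG; rewrite (l2dot_displacement N0 r_odd l repG (fr j)).
have int m k : cintegrable mu Om
    (fun x => G m k x * (fourier (f j) x m k)^* * (modulation l x)^*).
  apply: cintegrable_mul => //; first by apply: symbol_term_sq; exact: (repG m k).1.
  apply: sqintegrableJ => //.
  apply: (@sqintegrable_bounded _ _ _ mu Om mOm (Omega_ltoo R N0) _ 1).
    exact: cmeasurable_expi.
  by move=> x _; rewrite normc_expi.
transitivity (cint mu Om (fun x => \sum_m \sum_k
    G m k x * (fourier (f j) x m k)^* * (modulation l x)^*)).
  rewrite cint_sum//; last by move=> m; exact: cintegrable_sum.
  by apply: eq_bigr => m _; rewrite cint_sum.
apply: eq_cint => x _; rewrite /symbol mulr_suml.
by apply: eq_bigr => m _; rewrite mulr_suml.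
Qed.

Lemma GammaE m k x i c : Gamma f m k x i c =
  twist (odd c) (x + grid i) * fourier (f (half_ord c)) (x + grid i) m k.
Proof.
have U j : Upsilon f j m k x i 0 = fourier (f j) (x + grid i) m k.
  by rewrite mxE /grid; case: ifP => _; rewrite ?addrA.
rewrite mxE twist_grid; case: (odd c); last by rewrite U mul1r.
by rewrite /Psi mxE U.
Qed.

Lemma sum_half_odd (V : nmodType) (F : 'I_p -> bool -> V) :
  \sum_(c < 2 * p) F (half_ord c) (odd c) = \sum_j (F j false + F j true).
Proof.
have lt2 (jb : 'I_p * bool) : (jb.1.*2 + jb.2 < 2 * p)%N.
  by case: jb => [[j jp] []] /=; lia.
rewrite (reindex (fun jb => Ordinal (lt2 jb))) /=.
  transitivity (\sum_j \sum_b F j b).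
    rewrite pair_big /=; apply: eq_bigr => -[j b] _ /=.
    congr F; last by rewrite oddD odd_double /=; case: b.
    by apply/ord_inj => /=; case: b; lia.
  by apply: eq_bigr => j _; rewrite big_bool addrC.
exists (fun c => (half_ord c, odd c)) => [[j b] _|c _] /=.
  congr pair; last by rewrite oddD odd_double /=; case: b.
  by apply/ord_inj => /=; case: b; lia.
by apply/ord_inj => /=; rewrite addnC odd_double_half.
Qed.

Local Open Scope sesquilinear_scope.

Definition synthesis (w : 'I_n -> 'I_n -> 'cV[C]_(4 * N)) (x : TR) : 'cV[C]_(2 * p) :=
  \sum_m \sum_k (Gamma f m k x) ^t* *m w m k.

Lemma synthesisE w x c : synthesis w x c 0 = \sum_m \sum_k \sum_i
  (twist (odd c) (x + grid i) * fourier (f (half_ord c)) (x + grid i) m k)^* * w m k i 0.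
Proof.
rewrite summxE; apply: eq_bigr => m _; rewrite summxE; apply: eq_bigr => k _.
rewrite mxE; apply: eq_bigr => i _; congr (_ * _).
by rewrite mxE [_^T _ _]mxE GammaE.
Qed.

Lemma synthesis_fiber G x c :
  synthesis (fiber G x) x c 0 = fold (odd c) (symbol (half_ord c) G) x.
Proof.
rewrite synthesisE /fold /symbol.
under [RHS]eq_bigr do rewrite mulr_suml.
rewrite [RHS]exchange_big; apply: eq_bigr => m _.
under [RHS]eq_bigr do rewrite mulr_suml.
rewrite [RHS]exchange_big; apply: eq_bigr => k _.
by apply: eq_bigr => i _; rewrite conjcM [fiber _ _ _ _ _ _]mxE; ring.
Qed.

Lemma enorm_col_sq q (v : 'cV[C]_q) : enorm v ^+ 2 = \sum_i normc (v i 0) ^+ 2.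
Proof. by rewrite enorm_sq; apply: eq_bigr => i _; rewrite big_ord1. Qed.

Lemma synthesis_norm G x : enorm (synthesis (fiber G x) x) ^+ 2 =
  \sum_j (normc (fold false (symbol j G) x) ^+ 2
          + normc (fold true (symbol j G) x) ^+ 2).
Proof.
rewrite enorm_col_sq.
rewrite -(sum_half_odd (fun j b => normc (fold b (symbol j G) x) ^+ 2)).
by apply: eq_bigr => c _; rewrite synthesis_fiber.
Qed.

Section Represented.
Variable G : funM.
Hypothesis G_sq : forall m k, sqintegrable mu Om (G m k).

Let fold_symbol_sq b j : sqintegrable mu cell (fold b (symbol j G)).
Proof. by apply: fold_sq; exact: symbol_sq. Qed.

Let pair_integrable j : mu.-integrable cell (EFin \o (fun x =>
  normc (fold false (symbol j G) x) ^+ 2 + normc (fold true (symbol j G) x) ^+ 2)).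
Proof. exact: (integrableD mcell (fold_symbol_sq _ _).2 (fold_symbol_sq _ _).2). Qed.

Lemma synthesis_integrable : mu.-integrable cell
  (EFin \o (fun x => enorm (synthesis (fiber G x) x) ^+ 2)).
Proof.
have := integrable_bigsum mcell pair_integrable.
by apply: eq_integrable => // x _; rewrite /= synthesis_norm.
Qed.

Lemma synthesis_integral :
  \int[mu]_(x in cell) (enorm (synthesis (fiber G x) x) ^+ 2) =
  \sum_j (sqnorm mu cell (fold false (symbol j G))
          + sqnorm mu cell (fold true (symbol j G))).
Proof.
under eq_Rintegral do rewrite synthesis_norm.
rewrite (Rintegral_bigsum mcell)//; apply: eq_bigr => j _.
by rewrite RintegralD//; exact: (fold_symbol_sq _ _).2.
Qed.

Let fiber_term_integrable m k i : mu.-integrable cell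
  (EFin \o (fun x => normc (G m k (x + grid i)) ^+ 2)).
Proof. exact: (tiling_sqintegrable mcell mOm grid_tiling i (G_sq m k)).2. Qed.

Let fiberE m k x : enorm (fiber G x m k) ^+ 2 = \sum_i normc (G m k (x + grid i)) ^+ 2.
Proof. by rewrite enorm_col_sq; apply: eq_bigr => i _; rewrite mxE. Qed.

Let fiber_entry_integrable m k : mu.-integrable cell
  (EFin \o (fun x => enorm (fiber G x m k) ^+ 2)).
Proof.
have := integrable_bigsum mcell (fiber_term_integrable m k).
by apply: eq_integrable => // x _; rewrite /= fiberE.
Qed.

Lemma fiber_integrable : mu.-integrable cell
  (EFin \o (fun x => \sum_m \sum_k enorm (fiber G x m k) ^+ 2)).
Proof.
by apply: (integrable_bigsum mcell) => m; apply: (integrable_bigsum mcell) => k.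
Qed.

Lemma fiber_integral :
  \int[mu]_(x in cell) (\sum_m \sum_k enorm (fiber G x m k) ^+ 2) = matrix_sqnorm N G.
Proof.
rewrite (Rintegral_bigsum mcell) => [|m]; last by apply: (integrable_bigsum mcell) => k.
apply: eq_bigr => m _; rewrite (Rintegral_bigsum mcell)//; apply: eq_bigr => k _.
rewrite (tiling_sqnorm mcell mOm grid_tiling (G_sq m k)).
under eq_Rintegral do rewrite fiberE.
exact: (Rintegral_bigsum mcell).
Qed.

End Represented.

(** The even and the odd components of the synthesized vector are the two folds of the
    symbols, which [fold_parseval] integrates. *)
Theorem frame_sum g G : matrix_represents g G ->
  (\sum_(j < p) \esum_(l in [set: Lam])
     (normc (l2dot g (displacement l (f j))) ^+ 2)%:E =
   (step * \int[mu]_(x in cell) (enorm (synthesis (fiber G x) x) ^+ 2))%:E)%E.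
Proof.
move=> repG; have iG m k := (repG m k).1.
rewrite synthesis_integral// mulr_sumr -sumEFin; apply: eq_bigr => j _.
rewrite -fold_parseval; last exact: symbol_sq.
by apply: eq_esum => l _; rewrite (l2dot_symbol j l repG).
Qed.

Section Bounded.
Variable G : funM.
Hypothesis G_sq : forall m k, sqintegrable mu Om (G m k).

(** Cauchy-Schwarz over the $n^2$ matrix entries. *)
Lemma sqnorm_symbol_le j : sqnorm mu Om (symbol j G) <=
  n%:R * (n%:R * (b0 ^+ 2 * matrix_sqnorm N G)).
Proof.
have it m k := symbol_term_sq j (G_sq m k).
apply: le_trans (sqnorm_sum_le mOm _) _.
  by move=> m; apply: sqintegrable_sum => // k; exact: it.
rewrite card_ord ler_wpM2l// /matrix_sqnorm !mulr_sumr; apply: ler_sum => m _.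
apply: le_trans (sqnorm_sum_le mOm (it m)) _.
rewrite card_ord ler_wpM2l// mulr_sumr; apply: ler_sum => k _.
rewrite -lee_fin EFinM -!sqnormE//.
rewrite -ge0_integralZl_EFin ?sqr_ge0//; last 2 first.
- by move=> x _; rewrite lee_fin sqr_ge0.
- by apply/measurable_EFinP; exact: (measurable_normc2 (G_sq m k).1).
apply: ae_ge0_le_integral => //.
- by move=> x _; rewrite lee_fin sqr_ge0.
- by apply/measurable_EFinP; exact: (measurable_normc2 (it m k).1).
- by move=> x _; rewrite mule_ge0 ?lee_fin ?sqr_ge0.
- apply: emeasurable_funM => //.
  by apply/measurable_EFinP; exact: (measurable_normc2 (G_sq m k).1).
have aeF := ae_filter_ringOfSetsType mu.
apply: filterS (f_bound j) => x + Ox => /(_ Ox) fb.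
rewrite -EFinM lee_fin normcM exprMn mulrC ler_wpM2r ?sqr_ge0//.
have h := le_trans (normc_entry_le (fourier (f j) x) m k) fb.
by rewrite normcJ_sq lerXn2r// ?nnegrE ?normc_ge0// (le_trans (normc_ge0 _) h).
Qed.

(** Cauchy-Schwarz over the $4N$ grid points. *)
Lemma sqnorm_fold_le b (H : TR -> C) : sqintegrable mu Om H ->
  sqnorm mu cell (fold b H) <= (4 * N)%:R * sqnorm mu Om H.
Proof.
move=> iH.
have it := tiling_sqintegrable mcell mOm grid_tiling (F := _) ^~ (twisted_sq b iH).
apply: le_trans (sqnorm_sum_le mcell it) _.
rewrite card_ord ler_wpM2l// (tiling_sqnorm mcell mOm grid_tiling iH).
apply: ler_sum => i _; rewrite le_eqVlt; apply/orP; left; apply/eqP.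
apply: eq_Rintegral => x _; rewrite normcM normcJ_sq normc_expi mulr1//.
Qed.

Lemma synthesis_integral_le :
  step * \int[mu]_(x in cell) (enorm (synthesis (fiber G x) x) ^+ 2) <=
  (2 * p%:R * n%:R ^+ 2 * b0 ^+ 2) * matrix_sqnorm N G.
Proof.
rewrite synthesis_integral//.
have N4 : (4 * N)%:R != 0 :> R by rewrite pnatr_eq0 muln_eq0 -lt0n N0.
have le_j j : sqnorm mu cell (fold false (symbol j G)) +
    sqnorm mu cell (fold true (symbol j G)) <=
    (4 * N)%:R * (2 * n%:R ^+ 2 * b0 ^+ 2 * matrix_sqnorm N G).
  have iS := symbol_sq j G_sq.
  have h1 := sqnorm_fold_le false iS; have h2 := sqnorm_fold_le true iS.
  apply: le_trans (lerD h1 h2) _.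
  rewrite -mulrDr ler_wpM2l// -mulr2n -[leLHS]mulr_natl -!mulrA ler_wpM2l//.
  by apply: le_trans (sqnorm_symbol_le j) _; rewrite expr2 -!mulrA.
apply: (@le_trans _ _ (step * \sum_(j < p)
    (4 * N)%:R * (2 * n%:R ^+ 2 * b0 ^+ 2 * matrix_sqnorm N G))).
  by rewrite ler_wpM2l ?(ltW step_gt0)//; apply: ler_sum => j _.
rewrite sumr_const card_ord -mulr_natl le_eqVlt; apply/orP; left; apply/eqP.
by field; rewrite pnatr_eq0 -lt0n.
Qed.

Lemma synthesis_cmeasurable w c : cmeasurable cell (fun x => synthesis w x c 0).
Proof.
apply: (eq_cmeasurable (F := fun x : TR => \sum_m \sum_k \sum_i
  (twist (odd c) (x + grid i) * fourier (f (half_ord c)) (x + grid i) m k)^* * w m k i 0)) => [x|].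
  by rewrite synthesisE.
apply: cmeasurable_sum => m; apply: cmeasurable_sum => k; apply: cmeasurable_sum => i.
apply: cmeasurableM; last exact: cmeasurable_cst.
apply: cmeasurableJ.
have mF : cmeasurable Om (fun x : TR => twist (odd c) x *
    fourier (f (half_ord c)) x m k).
  by apply: cmeasurableM; [exact: cmeasurable_expi|exact: (fr _ m k).1.1].
exact: (tiling_cmeasurable mOm grid_tiling i mF).
Qed.

End Bounded.

End FrameSum.
End Fibers.
(** * Density of rational vectors *)

Section RationalApproximation.
Variable R : realType.
Local Notation C := R[i].
Local Notation Re := (@complex.Re R).
Local Notation Im := (@complex.Im R).

Definition ccvg (z : nat -> C) (l : C) :=
  (fun t => Re (z t)) @ \oo --> Re l /\ (fun t => Im (z t)) @ \oo --> Im l.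

Lemma ccvgMl (a : C) z l : ccvg z l -> ccvg (fun t => a * z t) (a * l).
Proof.
move=> [z1 z2]; split.
  rewrite cReM; under eq_fun do rewrite cReM.
  by apply: cvgB; apply: cvgM => //; exact: cvg_cst.
rewrite cImM; under eq_fun do rewrite cImM.
by apply: cvgD; apply: cvgM => //; exact: cvg_cst.
Qed.

Lemma cvg_seq_sum I (s : seq I) (u : I -> nat -> R) (l : I -> R) :
  (forall i, u i @ \oo --> l i) ->
  (fun t => \sum_(i <- s) u i t) @ \oo --> \sum_(i <- s) l i.
Proof.
move=> ul; elim: s => [|i s IH].
  by rewrite big_nil; under eq_fun do rewrite big_nil; exact: cvg_cst.
by rewrite big_cons; under eq_fun do rewrite big_cons; exact: cvgD.
Qed.

Lemma ccvg_sum I (s : seq I) (z : I -> nat -> C) (l : I -> C) :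
  (forall i, ccvg (z i) (l i)) ->
  ccvg (fun t => \sum_(i <- s) z i t) (\sum_(i <- s) l i).
Proof.
move=> zl; split.
  rewrite cRe_sum; under eq_fun do rewrite cRe_sum.
  by apply: cvg_seq_sum => i; exact: (zl i).1.
rewrite cIm_sum; under eq_fun do rewrite cIm_sum.
by apply: cvg_seq_sum => i; exact: (zl i).2.
Qed.

Lemma ccvg_normc2 z l : ccvg z l ->
  (fun t => normc (z t) ^+ 2) @ \oo --> normc l ^+ 2.
Proof.
move=> [z1 z2]; rewrite normc2E; under eq_fun do rewrite normc2E.
by apply: cvgD; apply: cvgM.
Qed.

Lemma rat_seq (a : R) : exists q : nat -> rat, (fun t => ratr (q t)) @ \oo --> a.
Proof.
have /choice[q hq] (t : nat) : exists q : rat, ratr q \in `]a, (a + t.+1%:R^-1)[.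
  by apply: rat_in_itvoo; rewrite ltrDl invr_gt0.
exists q; apply: (@squeeze_cvgr _ _ _ _ (fun=> a) (fun t => a + t.+1%:R^-1)).
- by apply: nearW => t; have := hq t; rewrite in_itv/= => /andP[/ltW -> /ltW].
- exact: cvg_cst.
- rewrite -[X in _ --> X]addr0; apply: cvgD; first exact: cvg_cst.
  exact: cvg_harmonic.
Qed.

Lemma crat_seq (z : C) : exists q : nat -> rat * rat,
  ccvg (fun t => ratr (q t).1 +i* ratr (q t).2) z.
Proof.
have [q1 h1] := rat_seq (Re z); have [q2 h2] := rat_seq (Im z).
by exists (fun t => (q1 t, q2 t)).
Qed.

End RationalApproximation.

(** * Frame bounds and fibers *)

Section FrameAndFibers.
Variables (R : realType) (N r : nat).
Hypotheses (N0 : (0 < N)%N) (r_odd : odd r).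
Local Notation mu := (@lebesgue_measure R).
Local Notation TR := (measurableTypeR R).
Local Notation C := R[i].
Local Notation Om := (Omega R N : set TR).
Local Notation Lam := (Lambda R N r).
Local Notation step := ((4 * N)%:R^-1 : R).
Local Notation cell := (`[0, step[%classic : set TR).
Variables (n p : nat) (f : 'I_p -> Lam -> 'M[C]_n) (b0 : R).
Hypothesis f_l2 : forall j, l2 (f j).
Hypothesis b0_gt0 : 0 < b0.
Hypothesis f_bound : forall j, {ae mu, forall x,
  Omega R N x -> enorm (fourier (f j) x) <= b0}.
Variable a0 : R.
Hypothesis a0_gt0 : 0 < a0.
Local Notation coeffs := ('I_n -> 'I_n -> 'cV[C]_(4 * N)).
Implicit Types (w : coeffs) (g : Lam -> 'M[C]_n).

Let mOm : measurable Om. Proof. exact: measurable_Omega. Qed.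
Let Omoo : (mu Om < +oo)%E. Proof. exact: Omega_ltoo. Qed.
Let mcell : measurable cell. Proof. exact: measurable_itv. Qed.
Let cell_ltoo : (mu cell < +oo)%E.
Proof. by rewrite lebesgue_measure_itv/=; case: ifP => _; rewrite ?sube0 ltry. Qed.
Let aeF := ae_filter_ringOfSetsType mu.

Definition fiber_bound (x : R) w := (4 * N)%:R * a0 * (\sum_m \sum_k enorm (w m k) ^+ 2)
  <= enorm (synthesis f w x) ^+ 2.

(** The fiberwise inequality integrates to the lower bound; the upper bound comes
    from the bound on the Fourier transforms alone. *)
Lemma frame_of_fibers : (0 < n)%N -> (0 < p)%N ->
  {ae mu, forall x, cell x -> forall w, fiber_bound x w} ->
  DFNS_with_lower_bound f a0.
Proof.
move=> n0 p0 fib; split=> //; exists (2 * p%:R * n%:R ^+ 2 * b0 ^+ 2).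
  by rewrite !mulr_gt0 ?exprn_gt0 ?ltr0n.
move=> g gl2; have repG := fourier_represents N0 r_odd gl2.
set G := (fun _ _ => _) in repG; have iG m k := (repG m k).1.
rewrite (frame_sum N0 r_odd f_l2 f_bound repG) (l2norm_sq N0 r_odd repG) !lee_fin.
split; last exact: synthesis_integral_le.
have N4 : 0 < (4 * N)%:R :> R by rewrite ltr0n muln_gt0.
rewrite ler_pdivlMl// mulrA -(fiber_integral N0 iG).
have i1 := fiber_integrable N0 iG.
have i2 := synthesis_integrable N0 r_odd f_l2 f_bound iG.
rewrite -RintegralZl// -lee_fin /Rintegral !fineK; last 2 first.
- exact: (integrable_fin_num mcell i2).
- exact: (integrable_fin_num mcell (integrableZl mcell ((4 * N)%:R * a0) i1)).
apply: ae_ge0_le_integral => //.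
- move=> x _; rewrite lee_fin; apply: mulr_ge0; first by rewrite mulr_ge0 ?ltW.
  by apply: sumr_ge0 => m _; apply: sumr_ge0 => k _; exact: sqr_ge0.
- exact: (measurable_int mu (integrableZl mcell ((4 * N)%:R * a0) i1)).
- by move=> x _; rewrite lee_fin sqr_ge0.
- exact: (measurable_int mu i2).
by apply: filterS fib => x + cx => /(_ cx) fx; rewrite lee_fin; exact: fx.
Qed.

Lemma enorm0 q t : enorm (0 : 'M[C]_(q, t)) ^+ 2 = 0.
Proof.
rewrite enorm_sq big1// => i _; rewrite big1// => j _.
by rewrite mxE normc0 expr0n.
Qed.

Lemma synthesis0 x : synthesis f (fun _ _ => 0) x = 0.
Proof. by rewrite /synthesis big1// => m _; rewrite big1// => k _; rewrite mulmx0. Qed.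

Section Test.
Variables (w : coeffs) (A : set TR).
Hypotheses (mA : measurable A) (Acell : A `<=` cell).

(** The function on $\Omega$ with fibers $1_Aw$. *)
Definition test_function m k (y : TR) : C :=
  \sum_i w m k i 0 * (\1_A (y - grid R i) : R)%:C.

Lemma test_function_sq m k : sqintegrable mu Om (test_function m k).
Proof.
apply: sqintegrable_sum => // i; apply: sqintegrableZl => //.
apply: (@sqintegrable_bounded _ _ _ mu Om mOm Omoo _ 1).
  split; last exact: measurable_cst.
  have mt : measurable_fun Om (fun y : TR => y - grid R i).
    exact: (measurable_translation (- grid R i)).
  have m1 : measurable_fun setT (\1_A : TR -> R) by exact: measurable_indic.
  exact: (measurable_comp measurableT (@subsetT _ _) m1 mt).
move=> x _; rewrite /= expr0n addr0 sqrtr_sqr indicE.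
by case: (_ \in _); rewrite ?normr1 ?normr0.
Qed.

Lemma fiber_test_function x : cell x ->
  fiber N test_function x = if x \in A then w else (fun _ _ => 0).
Proof.
move=> cx; apply/funext => m; apply/funext => k; apply/colP => i.
rewrite mxE /test_function (bigD1 i)//= big1 ?addr0; last first.
  move=> i' i'i; rewrite indicE memNset ?mulr0// => /Acell h.
  have [_ _ uniq_i] := grid_tiling R N0.
  have ci : cell (x + grid R i - grid R i) by rewrite addrK.
  by rewrite (uniq_i _ _ _ h ci) eqxx in i'i.
rewrite addrK indicE; case: (x \in A); first by rewrite mulr1.
by rewrite mulr0 mxE.
Qed.

Lemma frame_test_function : DFNS_with_lower_bound f a0 ->
  (4 * N)%:R * a0 * \int[mu]_(x in cell)
      (\1_A x * \sum_m \sum_k enorm (w m k) ^+ 2) <=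
  \int[mu]_(x in cell) (\1_A x * enorm (synthesis f w x) ^+ 2).
Proof.
move=> [_ [b _ fr]]; pose G := test_function; have iG := test_function_sq.
pose g (l : Lam) : 'M[C]_n := \matrix_(m, k) inner mu Om (G m k) (lwave l).
have onb := lwave_orthonormal R N0 r_odd; have tot := @lwave_total R N r N0 r_odd.
have repG : matrix_represents g G.
  move=> m k; have := fourier_series_represents mOm Omoo onb tot (iG m k).
  by congr represents; apply/funext => l; rewrite mxE.
have [+ _] := fr g (matrix_represents_l2 N0 r_odd repG).
rewrite (frame_sum N0 r_odd f_l2 f_bound repG) (l2norm_sq N0 r_odd repG) lee_fin.
have N4 : 0 < (4 * N)%:R :> R by rewrite ltr0n muln_gt0.
rewrite ler_pdivlMl// mulrA -(fiber_integral N0 iG).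
rewrite (_ : \int[mu]_(x in cell) (\sum_m \sum_k enorm (fiber N G x m k) ^+ 2) =
  \int[mu]_(x in cell) (\1_A x * \sum_m \sum_k enorm (w m k) ^+ 2)); last first.
  apply: eq_Rintegral => x /set_mem cx; rewrite (fiber_test_function cx) indicE.
  case: (x \in A); first by rewrite mul1r.
  by rewrite mul0r big1// => m _; rewrite big1// => k _; rewrite enorm0.
rewrite (_ : \int[mu]_(x in cell) (enorm (synthesis f (fiber N G x) x) ^+ 2) =
  \int[mu]_(x in cell) (\1_A x * enorm (synthesis f w x) ^+ 2))//.
apply: eq_Rintegral => x /set_mem cx; rewrite (fiber_test_function cx) indicE.
by case: (x \in A); rewrite ?mul1r// mul0r synthesis0 enorm0.
Qed.

Lemma test_synthesis_integrable :
  mu.-integrable cell (EFin \o (fun x => \1_A x * enorm (synthesis f w x) ^+ 2)).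
Proof.
have := synthesis_integrable N0 r_odd f_l2 f_bound test_function_sq.
apply: eq_integrable => // x /set_mem cx; rewrite /= (fiber_test_function cx) indicE.
by case: (x \in A); rewrite ?mul1r// mul0r synthesis0 enorm0.
Qed.

End Test.

(** For a fixed $w$ the set where the fiber bound fails is null, since otherwise
    the function with fibers $1_Aw$, for this set $A$, violates the frame bound. *)
Lemma fiber_bound_ae w : DFNS_with_lower_bound f a0 ->
  {ae mu, forall x, cell x -> fiber_bound x w}.
Proof.
move=> fr; pose P := \sum_m \sum_k enorm (w m k) ^+ 2.
pose Q x := enorm (synthesis f w x) ^+ 2; pose c := (4 * N)%:R * a0 * P.
have mQ : measurable_fun cell Q.
  have -> : Q = fun x => \sum_i normc (synthesis f w x i 0) ^+ 2.
    by apply/funext => x; exact: enorm_col_sq.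
  apply: measurable_sum => i; apply: measurable_normc2.
  exact: synthesis_cmeasurable.
pose A : set TR := cell `&` Q @^-1` `]-oo, c[.
have mA : measurable A by apply: mQ => //; exact: measurable_itv.
have Acell : A `<=` cell by move=> x [].
have AP x : cell x -> (x \in A) = (Q x < c).
  move=> cx; apply/idP/idP => [/set_mem[_]|Qc]; first by rewrite /= in_itv.
  by apply/mem_set; split => //=; rewrite in_itv.
pose dfn x : R := c * \1_A x - \1_A x * Q x.
have iQ : mu.-integrable cell (EFin \o (fun x => \1_A x * Q x)).
  exact: test_synthesis_integrable.
have i1 : mu.-integrable cell (EFin \o (\1_A : TR -> R)).
  apply: (@measurable_bounded_integrable _ _ _ mu _ _ mcell cell_ltoo) => //.
  exists 1; split => // M M1 x _ /=; rewrite indicE.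
  by case: (_ \in _); rewrite ?normr1 ?normr0; apply: ltW => //; apply: lt_trans M1.
have ic1 : mu.-integrable cell (EFin \o (fun x => c * \1_A x)).
  exact: (integrableZl mcell c i1).
have id : mu.-integrable cell (EFin \o dfn) by exact: (integrableB mcell ic1 iQ).
have d0 x : cell x -> 0 <= dfn x.
  move=> cx; rewrite /dfn indicE AP//; case: ltP => [Qc|_].
    by rewrite mulr1 mul1r subr_ge0 ltW.
  by rewrite mulr0 mul0r subrr.
have dint : \int[mu]_(x in cell) dfn x = 0.
  apply/eqP; rewrite eq_le Rintegral_ge0// andbT.
  rewrite RintegralB// RintegralZl// subr_le0.
  apply: le_trans (frame_test_function w mA Acell fr); rewrite -/P.
  by rewrite RintegralZr// [_ * P]mulrC mulrA.
have : ae_eq mu cell (EFin \o dfn) (cst 0%E).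
  apply/(ae_eq_integral_abs mu mcell); first exact: (measurable_int mu id).
  rewrite (eq_integral (EFin \o dfn)); last first.
    by move=> x /set_mem cx; rewrite gee0_abs// lee_fin d0.
  by rewrite -[LHS]fineK ?[fine _]dint//; exact: (integrable_fin_num mcell id).
apply: filterS => x + cx => /(_ cx) [dx0]; rewrite /fiber_bound -/P -/c -/(Q x).
rewrite leNgt; apply/negP => Qc; move: dx0; rewrite /dfn indicE AP// Qc.
by rewrite mulr1 mul1r => /eqP; rewrite subr_eq0 gt_eqF.
Qed.

Definition rational_coeffs (q : {ffun 'I_n * 'I_n * 'I_(4 * N) -> rat * rat}) : coeffs :=
  fun m k => \col_i (ratr (q (m, k, i)).1 +i* ratr (q (m, k, i)).2).

(** Both sides of the inequality are continuous in $w$. *)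
Lemma fiber_bound_dense x :
  (forall q, fiber_bound x (rational_coeffs q)) -> forall w, fiber_bound x w.
Proof.
move=> hq w.
have /choice[q qw] (t : 'I_n * 'I_n * 'I_(4 * N)) := crat_seq (w t.1.1 t.1.2 t.2 0).
pose wt t := rational_coeffs [ffun s => q s t].
have wtw m k i : ccvg (fun t => wt t m k i 0) (w m k i 0).
  by have := qw (m, k, i); congr ccvg; apply/funext => t; rewrite mxE ffunE.
have cP : (fun t => (4 * N)%:R * a0 * (\sum_m \sum_k enorm (wt t m k) ^+ 2)) @ \oo
    --> (4 * N)%:R * a0 * (\sum_m \sum_k enorm (w m k) ^+ 2).
  apply: cvgM; first exact: cvg_cst.
  apply: cvg_seq_sum => m; apply: cvg_seq_sum => k; rewrite enorm_col_sq.
  under eq_fun do rewrite enorm_col_sq.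
  by apply: cvg_seq_sum => i; exact: ccvg_normc2.
have cQ : (fun t => enorm (synthesis f (wt t) x) ^+ 2) @ \oo
    --> enorm (synthesis f w x) ^+ 2.
  rewrite enorm_col_sq; under eq_fun do rewrite enorm_col_sq.
  apply: cvg_seq_sum => c; apply: ccvg_normc2.
  rewrite synthesisE//; under eq_fun do rewrite synthesisE//.
  apply: ccvg_sum => m; apply: ccvg_sum => k; apply: ccvg_sum => i.
  exact: ccvgMl.
by apply: ler_cvg_to cP cQ _; apply: nearW => t; exact: hq.
Qed.

(** The exceptional null sets of the countably many rational vectors are discarded
    together. *)
Lemma fibers_of_frame : DFNS_with_lower_bound f a0 ->
  {ae mu, forall x, cell x -> forall w, fiber_bound x w}.
Proof.
move=> fr.
have : {ae mu, forall x, forall t : nat,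
    forall q : {ffun 'I_n * 'I_n * 'I_(4 * N) -> rat * rat},
    choice.unpickle t = Some q -> cell x -> fiber_bound x (rational_coeffs q)}.
  apply: ae_foralln => t.
  case: (choice.unpickle t) => [q|]; last by apply: aeW => x q.
  by apply: filterS (fiber_bound_ae (rational_coeffs q) fr) => x h _ [<-].
apply: filterS => x hx cx; apply: fiber_bound_dense => q.
exact: (hx (choice.pickle q) q (choice.pickleK q) cx).
Qed.

End FrameAndFibers.
Local Open Scope sesquilinear_scope.

Theorem theorem2p12 (R : realType) (n N r p : nat)
    (n_gt0 : (0 < n)%N) (N_gt0 : (0 < N)%N) (p_gt0 : (0 < p)%N)
    (r_odd : odd r) (r_coprime : coprime r N)
    (r_ge1 : (1 <= r)%N) (r_le : (r <= 2 * N - 1)%N)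
    (f : 'I_p -> Lambda R N r -> 'M[R[i]]_n)
    (f_l2 : forall j, l2 (f j))
    (f_neq0 : forall j, exists l, f j l != 0)
    (b0 : R) (b0_gt0 : 0 < b0)
    (f_bound : forall j, {ae (@lebesgue_measure R), forall x,
       Omega R N x -> enorm (fourier (f j) x) <= b0})
    (a0 : R) (a0_gt0 : 0 < a0) :
  DFNS_with_lower_bound f a0 <->
  {ae (@lebesgue_measure R), forall x, 0 < x < 1 / (4 * N)%:R ->
     forall w : 'I_n -> 'I_n -> 'cV[R[i]]_(4 * N),
       (4 * N)%:R * a0 * (\sum_m \sum_k enorm (w m k) ^+ 2) <=
       enorm (\sum_m \sum_k (Gamma f m k x) ^t* *m w m k) ^+ 2}.
Proof.
have aeF := ae_filter_ringOfSetsType (@lebesgue_measure R).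
split=> [fr|fib].
  have := fibers_of_frame N_gt0 r_odd f_l2 f_bound fr.
  apply: filterS => x fx /andP[x0 x1] w; apply: fx.
  by rewrite /= in_itv/= ltW//= -div1r.
apply: (frame_of_fibers N_gt0 r_odd f_l2 b0_gt0 f_bound a0_gt0 n_gt0 p_gt0).
have n0 : (@lebesgue_measure R).-negligible [set 0 : R].
  apply/negligibleP; first exact: measurable_set1.
  exact: lebesgue_measure_set1.
have ne0 : {ae (@lebesgue_measure R), forall x : R, x != 0}.
  by apply: negligibleS n0 => x /= /negP; rewrite negbK => /eqP.
apply: filterS2 fib ne0 => x fx x0; rewrite /= in_itv/= => /andP[xge xlt] w.
by apply: fx; rewrite lt_neqAle eq_sym x0 xge/= div1r.
Qed.
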